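(* Let $\nu>0$, and let $\{p_{n,\nu}\}_{n=0}^\infty$ be the monic sequence of orthogonal polynomials with respect to $\mathcal{L}$. Then it satisfies the three-term recurrence relation $$p_{n,\nu}(x)-x\,p_{n-1,\nu}(x)+\gamma_n\,p_{n-2,\nu}(x)=0,\qquad n=1,2,\dots,$$ where $p_{-1,\nu}(x)=0$, $\gamma_1=\frac{\nu+2}{2\nu(\nu+1)}$ and $$\gamma_n=\frac{1}{4(\nu+n-1)(\nu+n-2)}\,\frac{q_{n+1,\nu}(1/\nu)\,q_{n-2,\nu}(1/\nu)}{q_{n,\nu}(1/\nu)\,q_{n-1,\nu}(1/\nu)},\qquad n=2,3,\dots,$$ with initial conditions $p_{0,\nu}(x)=1$ and $p_{1,\nu}(x)=x$.
   Context: For $\nu>0$, $J_\nu$ is the Bessel function of the first kind, $0<j'_{\nu,1}<j'_{\nu,2}<\cdots$ are the positive zeros of its derivative $J_\nu'$, and $j'_{\nu,-k}=-j'_{\nu,k}$ for $k\in\mathbb{N}$. The moment functional $\mathcal{L}$ is defined on polynomials by $$\mathcal{L}(f)=\sum_{k\in\mathbb{Z}\setminus\{0\}}\frac{1}{(j'_{\nu,k})^2}\,f(1/j'_{\nu,k}).$$ It is positive definite. The monic orthogonal polynomials with respect to $\mathcal{L}$ are the monic polynomials $p_{n,\nu}$ of degree $n$ with $\mathcal{L}(p_{m,\nu}p_{n,\nu})=0$ for $m\ne n$. The polynomials $q_{n,\nu}$ are defined by $q_{0,\nu}(x)=1$, $q_{1,\nu}(x)=x/2$ and $q_{n+1,\nu}(x)=x\,q_{n,\nu}(x)-\beta_n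 q_{n-1,\nu}(x)$ for $n\ge1$, where $\beta_n=\frac{1}{4(\nu+n-1)(\nu+n)}$. *)

(* Defs.v *)
From HB Require Import structures.
From mathcomp Require Import all_boot all_order all_algebra.
From mathcomp Require Import all_classical all_reals all_analysis.

Set Implicit Arguments.
Unset Strict Implicit.
Unset Printing Implicit Defensive.

Import Order.TTheory GRing.Theory Num.Theory.
Import numFieldNormedType.Exports.

Local Open Scope classical_set_scope.
Local Open Scope ring_scope.

(* Euler's integral; only used for s > 0. *)
Definition Gamma (R : realType) (s : R) : R :=
  \int[@lebesgue_measure R]_(t in `]0, +oo[) (t `^ (s - 1) * expR (- t)).

(* The usual series; [powR] makes it meaningful for x > 0 only, which is all
   that the positive zeros of the derivative require. *)
Definition besselJ (R : realType) (nu x : R) : R :=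
  \big[+%R/0]_(0 <= m <oo)
    ((-1) ^+ m / (m`!%:R * Gamma (m%:R + nu + 1)) * (x / 2) `^ (2 * m%:R + nu)).

(* [j k], for k : int, is j'_{nu,k}; the value [j 0] is irrelevant.  These
   conditions determine [j k] for every k != 0. *)
Record besselJ'_zeros (R : realType) (nu : R) (j : int -> R) : Prop := {
  zeros_gt0 : forall k : nat, (0 < k)%N -> 0 < j k%:Z;
  zeros_increasing : forall k : nat, (0 < k)%N -> j k%:Z < j k.+1%:Z;
  zerosP : forall x : R, 0 < x ->
    (derive1 (besselJ nu) x = 0 <-> exists2 k : nat, (0 < k)%N & x = j k%:Z);
  zerosN : forall k : nat, (0 < k)%N -> j (- k%:Z) = - j k%:Z
}.

(* The sum over k in Z \ {0}, split into its positive and negative halves. *)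
Definition moment_functional (R : realType) (j : int -> R) (f : {poly R}) : R :=
  let term (k : int) := (j k ^+ 2)^-1 * f.[(j k)^-1] in
  \big[+%R/0]_(1 <= k <oo) term k%:Z + \big[+%R/0]_(1 <= k <oo) term (- k%:Z).

Record monic_orthogonal (R : realType) (L : {poly R} -> R)
    (p : nat -> {poly R}) : Prop := {
  ortho_monic : forall n, p n \is monic;
  ortho_degree : forall n, size (p n) = n.+1;
  ortho_eq0 : forall m n, m != n -> L (p m * p n) = 0
}.

Definition beta_coef (R : realType) (nu : R) (n : nat) : R :=
  1 / (4 * (nu + n%:R - 1) * (nu + n%:R)).

Fixpoint q (R : realType) (nu : R) (n : nat) : {poly R} :=
  match n with
  | 0 => 1
  | 1 => 2^-1 *: 'X
  | (k.+1 as m).+1 => 'X * q nu m - beta_coef nu m *: q nu k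
  end.

(* Only used for n >= 1. *)
Definition gamma_coef (R : realType) (nu : R) (n : nat) : R :=
  if n == 1%N then (nu + 2) / (2 * nu * (nu + 1))
  else 1 / (4 * (nu + n%:R - 1) * (nu + n%:R - 2)) *
       (((q nu (n + 1)).[1 / nu] * (q nu (n - 2)).[1 / nu]) /
        ((q nu n).[1 / nu] * (q nu (n - 1)).[1 / nu])).

(* Extends a sequence of polynomials by 0 to negative indices. *)
Definition extend (R : realType) (p : nat -> {poly R}) (n : int) : {poly R} :=
  match n with
  | Posz k => p k
  | Negz _ => 0
  end.

(* Main.v *)
(* Put s = z^2 and let R_n(s) = z^n q_n(1/z), so that R_{n+1} = R_n - beta_n s R_{n-1}.
   Let b_n(s) be J_{nu+n}(z) divided by its leading term.  The Casoratian of R_n and b_n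
   is constant and equals G(s) = b_0/2 - beta_1 s b_1, which is J'_nu(z) up to a nonvanishing
   factor; as b_n -> 1, it follows that R_n -> G, pointwise and coefficientwise.

   R_n is real-rooted, R_n = 1/2 prod_i (1 - y_{n,i} s), and by interlacing y_{n,i} is
   nondecreasing in n.  Passing to the limit in the product shows that the numbers
   1 / lim_n y_{n,i} are zeros of G, that there are no other positive zeros, and, as the
   positive zeros of G are simple, that they are distinct.  Hence lim_n y_{n,i} is
   1/(j'_{nu,i+1})^2.  By monotone convergence the power sums of the y_{n,i} converge to
   the moments of L, so Newton's identities for R_n give -2 G' = G * sum_m L(x^{2m}) s^m.
   This replaces the Hadamard factorization of J'_nu.

   The rest is formal.  One has 4 nu s G' = (nu^2 - s) b_0 - 2 nu^2 G, and R_n is a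
   Pade denominator of b_0 / G.  The polynomials defined by the recurrence with
   coefficients gamma_n are the Christoffel kernels of q_n at 1/nu and -1/nu, and the two
   facts above yield their orthogonality with respect to L. *)
Require Import Defs.
From HB Require Import structures.
From mathcomp Require Import all_boot all_order all_algebra.
From mathcomp Require Import all_classical all_reals all_analysis.
From mathcomp Require Import measurable_realfun polyrcf.
From mathcomp Require Import ring lra zify.

Set Implicit Arguments.
Unset Strict Implicit.
Unset Printing Implicit Defensive.

Import Order.TTheory GRing.Theory Num.Theory.
Import numFieldNormedType.Exports.

Local Open Scope ring_scope.

(** * Euler's Gamma function *)

Section GammaFunction.
Local Open Scope classical_set_scope.
Variable R : realType.
Notation mu := (@lebesgue_measure R).

Definition Gamma_integrand (s t : R) : R := t `^ (s - 1) * expR (- t).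

Lemma Gamma_integrand_ge0 s t : 0 <= Gamma_integrand s t.
Proof. by rewrite mulr_ge0 ?powR_ge0 ?expR_ge0. Qed.

Lemma measurable_Gamma_integrand s D : measurable_fun D (Gamma_integrand s).
Proof.
apply: measurable_funTS; apply: measurable_funM; first exact: measurable_powR.
by apply: measurableT_comp => //; exact: measurable_expR.
Qed.

(** From [ln u <= u] at [u = t / (2 * a)]: [a * ln t] is then at most [a * ln (2 * a) + t / 2]. *)
Lemma powR_le_exp (a : R) : 0 < a ->
  exists2 C : R, 0 < C & forall t, 0 <= t -> t `^ a <= C * expR (t / 2).
Proof.
move=> a0; exists (expR (a * ln (2 * a))); first exact: expR_gt0.
move=> t; rewrite le_eqVlt => /orP[/eqP<-|t0].
  by rewrite powR0 ?gt_eqF// mul0r expR0 mulr1 expR_ge0.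
rewrite /powR gt_eqF// -expRD ler_expR.
have a2 : 0 < 2 * a by rewrite mulr_gt0.
have -> : t = 2 * a * (t / (2 * a)) by field; rewrite gt_eqF.
rewrite lnM ?posrE ?divr_gt0//.
have : ln (t / (2 * a)) <= t / (2 * a).
  have u0 : 0 < t / (2 * a) by rewrite divr_gt0.
  have : 1 + ln (t / (2 * a)) <= expR (ln (t / (2 * a))) by exact: expR_ge1Dx.
  by rewrite lnK ?posrE//; lra.
move=> h; rewrite mulrDr lerD2l (le_trans (ler_wpM2l (ltW a0) h))//.
set u := t / _; by lra.
Qed.

Lemma powR_continuous_at (a t : R) : 0 < t -> {for t, continuous (fun t => t `^ a)}.
Proof.
move=> t0; apply: differentiable_continuous; apply/derivable1_diffP.
by apply: derivable_powR; rewrite in_itv/= t0.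
Qed.

Lemma powR_derivable_oo_LRcontinuous (a b : R) : 0 < a -> 0 < b ->
  derivable_oo_LRcontinuous (fun t => t `^ a) 0 b.
Proof.
move=> a0 b0; split.
- by move=> t; rewrite in_itv/= => /andP[t0 _]; apply: derivable_powR; rewrite in_itv/= t0.
- by rewrite powR0 ?gt_eqF//; exact: powR_cvg0.
- by apply: cvg_at_left_filter; exact: powR_continuous_at.
Qed.

Lemma Gamma_fin_num s : 1 < s ->
  ((\int[mu]_(t in `[0%R, +oo[) (Gamma_integrand s t)%:E) \is a fin_num)%E.
Proof.
move=> s1; have [C C0 hC] := @powR_le_exp (s - 1) (ltac:(lra)).
rewrite ge0_fin_numE; last first.
  by apply: integral_ge0 => t _; rewrite lee_fin Gamma_integrand_ge0.
have h2 : 0 < (2^-1 : R) by rewrite invr_gt0.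
(* The integrand is at most [C * expR (- t / 2)], which is [2 * C] times the exponential density of
   rate 1/2, of total mass 1. *)
apply: (@le_lt_trans _ _
  (\int[mu]_(t in `[0%R, +oo[) ((C * 2)%:E * (exponential_pdf 2^-1 t)%:E))%E); last first.
  rewrite ge0_integralZl//; last 3 first.
  - apply/measurable_EFinP; apply: measurable_funTS; exact: measurable_exponential_pdf.
  - by move=> t _; rewrite lee_fin exponential_pdf_ge0// ltW.
  - by rewrite lee_fin; lra.
  rewrite lte_mul_pinfty ?lee_fin//; first lra.
  apply: (@le_lt_trans _ _ (\int[mu]_t (exponential_pdf 2^-1 t)%:E)%E).
    apply: ge0_subset_integral => //.
      by apply/measurable_EFinP; exact: measurable_exponential_pdf.
    by move=> t _; rewrite lee_fin exponential_pdf_ge0// ltW.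
  by rewrite integral_exponential_pdf// ltry.
apply: ge0_le_integral => //.
- by move=> t _; rewrite lee_fin Gamma_integrand_ge0.
- by apply/measurable_EFinP; exact: measurable_Gamma_integrand.
- apply: measurable_funeM; apply/measurable_EFinP; apply: measurable_funTS.
  exact: measurable_exponential_pdf.
- move=> t; rewrite /= in_itv/= andbT => t0; rewrite -EFinM lee_fin.
  rewrite exponential_pdfE// /Gamma_integrand.
  have := ler_wpM2r (expR_ge0 (- t)) (hC _ t0).
  rewrite -mulrA -expRD (_ : t / 2 - t = - 2^-1 * t); last by lra.
  by rewrite (_ : C * 2 * (2^-1 * _) = C * expR (- 2^-1 * t)) //; lra.
Qed.

Lemma expRN_continuous : continuous (fun t : R => expR (- t)).
Proof.
by move=> t; apply: continuous_comp; [exact: continuousN|exact: continuous_expR].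
Qed.

Lemma integrable_Gamma_integrand s b : 1 < s -> 0 < b ->
  mu.-integrable `[0, b] (EFin \o Gamma_integrand s).
Proof.
move=> s1 b0; apply: continuous_compact_integrable; first exact: segment_compact.
have c1 : {within `[0, b], continuous (fun t => t `^ (s - 1))}.
  by apply/derivable_oo_LRcontinuous_within/powR_derivable_oo_LRcontinuous; lra.
have c2 : {within `[0, b], continuous (fun t : R => expR (- t))}.
  exact/continuous_subspaceT/expRN_continuous.
have c3 : {within `[0, b], continuous (fun t : R => t `^ (s - 1) * expR (- t))}.
  by move=> t; exact: (continuousM (c1 t) (c2 t)).
exact: c3.
Qed.

Lemma GammaE s : Gamma s = fine (\int[mu]_(t in `[0%R, +oo[) (Gamma_integrand s t)%:E)%E.
Proof.
rewrite /Gamma /Rintegral; congr fine; apply: integral_itv_obnd_cbnd.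
by apply/measurable_EFinP; exact: measurable_Gamma_integrand.
Qed.

Lemma Gamma_cvg s : 1 < s ->
  \int[mu]_(t in `[0, n.+1%:R]) Gamma_integrand s t @[n --> \oo] --> Gamma s.
Proof.
move=> s1; rewrite GammaE; apply: fine_cvg; rewrite fineK ?Gamma_fin_num//.
have -> : (`[0%R, +oo[)%classic = \bigcup_n `[0%R, n.+1%:R : R]%classic.
  apply/seteqP; split => t /=.
    rewrite in_itv/= andbT => t0; exists (Num.truncn t) => //=.
    by rewrite in_itv/= t0/= ltW// truncnS_gt.
  by move=> [n _] /=; rewrite !in_itv/= => /andP[->].
apply: ge0_nondecreasing_set_cvg_integral => //=.
- apply/nondecreasing_seqP => n; rewrite subsetEset => t /=.
  rewrite !in_itv/= => /andP[-> h]; apply: (le_trans h).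
  by rewrite ler_nat.
- by move=> i; apply/measurable_EFinP; exact: measurable_Gamma_integrand.
- by move=> n t _; rewrite lee_fin Gamma_integrand_ge0.
Qed.

(** Integration by parts on [[0, n+1]]; the boundary term at [n+1] vanishes in the limit. The bound
    [1 < s] keeps [t^(s-1)] continuous at 0. *)
Lemma Gamma_rec (s : R) : 1 < s -> Gamma (s + 1) = s * Gamma s.
Proof.
move=> s1; have s0 : 0 < s by lra.
have H1 : \int[mu]_(t in `[0, n.+1%:R]) Gamma_integrand (s + 1) t @[n --> \oo]
    --> Gamma (s + 1) by apply: Gamma_cvg; lra.
have [C C0 hC] := powR_le_exp s0.
have H2 : (- (n.+1%:R `^ s * expR (- n.+1%:R)) + s *
    \int[mu]_(t in `[0, n.+1%:R]) Gamma_integrand s t) @[n --> \oo] --> 0 + s * Gamma s.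
  apply: cvgD; last by apply: cvgMr; exact: Gamma_cvg.
  rewrite -oppr0; apply: cvgN.
  have H3 : C * expR (- (2^-1 * n.+1%:R)) @[n --> \oo] --> (0 : R).
    rewrite -[X in _ --> X](mulr0 C); apply: cvgMr.
    have -> : (fun n => expR (- (2^-1 * n.+1%:R))) = (fun n => expR (- 2^-1 : R) ^+ n.+1).
      by apply/funext => n; rewrite -expRM_natl mulrN mulrC.
    rewrite (@cvg_shiftS _ (fun n => expR (- 2^-1 : R) ^+ n)); apply: cvg_expr.
    by rewrite ger0_norm ?expR_ge0// expR_lt1 oppr_lt0 invr_gt0.
  apply: (squeeze_cvgr _ (cvg_cst 0) H3); apply: nearW => n.
  rewrite mulr_ge0 ?powR_ge0 ?expR_ge0//=.
  apply: (le_trans (ler_wpM2r (expR_ge0 _) (hC _ (ler0n _ _)))).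
  by rewrite -mulrA -expRD (_ : _ / 2 - _ = - (2^-1 * n.+1%:R))//; lra.
suff E : forall n : nat, \int[mu]_(t in `[0, n.+1%:R]) Gamma_integrand (s + 1) t =
  - (n.+1%:R `^ s * expR (- n.+1%:R)) + s *
    \int[mu]_(t in `[0, n.+1%:R]) Gamma_integrand s t.
  rewrite add0r in H2; move: H1; under eq_fun do rewrite E.
  by move=> H1; exact: (cvg_unique _ H1 H2).
move=> n.
have n0 : (0 : R) < n.+1%:R by rewrite ltr0n.
have := @Rintegration_by_parts R (fun t => t `^ s) (fun t => - expR (- t))
  (fun t => s * t `^ (s - 1)) (fun t => expR (- t)) 0 n.+1%:R n0.
have -> : (fun x => x `^ s * expR (- x)) = Gamma_integrand (s + 1).
  by apply/funext => t; rewrite /Gamma_integrand addrK.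
move=> ->.
- rewrite powR0 ?gt_eqF// mul0r subr0 mulrN; congr (_ + _).
  under eq_Rintegral do rewrite mulrN -mulrA -mulNr.
  rewrite RintegralZl//; last exact: integrable_Gamma_integrand.
  by rewrite mulNr opprK.
- have c1 : {within `[0, n.+1%:R], continuous (fun t => t `^ (s - 1))}.
    by apply/derivable_oo_LRcontinuous_within/powR_derivable_oo_LRcontinuous; lra.
  by move=> t; exact: (continuousM (@cst_continuous _ _ s t) (c1 t)).
- exact: powR_derivable_oo_LRcontinuous.
- move=> t; rewrite in_itv/= => /andP[t0 _]; rewrite powR_derive1//.
  by rewrite in_itv/= t0.
- exact/continuous_subspaceT/expRN_continuous.
- split=> [t _||].
  + exact: ex_derive.
  + by apply: cvg_at_right_filter; apply: cvgN; exact: expRN_continuous.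
  + by apply: cvg_at_left_filter; apply: cvgN; exact: expRN_continuous.
- move=> t _; rewrite derive1E; apply: derive_val; apply: is_derive_eq.
  by rewrite mulrN1 opprK.
Qed.

Lemma Gamma_gt0 (s : R) : 1 < s -> 0 < Gamma s.
Proof.
move=> s1; rewrite GammaE fine_gt0//.
have lb (t : R) : 1 <= t <= 2 -> expR (- 2) <= Gamma_integrand s t.
  move=> /andP[t1 t2]; rewrite -[leLHS]mul1r ler_pM ?expR_ge0 ?ler_expR ?lerN2//.
  by rewrite -[leLHS](powRr0 t) ler_powR// subr_ge0 ltW.
rewrite -ge0_fin_numE ?Gamma_fin_num ?andbT//; last first.
  by apply: integral_ge0 => t _; rewrite lee_fin Gamma_integrand_ge0.
apply: (@lt_le_trans _ _ (\int[mu]_(t in `[1%R, 2%R]) (expR (- 2))%:E)%E).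
  rewrite integral_cst//= lebesgue_measure_itv/= lte_fin.
  by rewrite ltr1n/= -EFinB -EFinM lte_fin mulr_gt0 ?expR_gt0//; lra.
apply: (@le_trans _ _ (\int[mu]_(t in `[1%R, 2%R]) (Gamma_integrand s t)%:E)%E).
  apply: ge0_le_integral => //=.
  by apply/measurable_EFinP; exact: measurable_Gamma_integrand.
apply: ge0_subset_integral => //=.
- by apply/measurable_EFinP; exact: measurable_Gamma_integrand.
- by move=> t _; rewrite lee_fin Gamma_integrand_ge0.
- by move=> t /=; rewrite !in_itv/= => /andP[t1 _]; rewrite andbT; lra.
Qed.

End GammaFunction.

(** * Reversed polynomials and their roots *)

(* The reversal of [q nu n], in the variable x^2; see [horner_q]. *)
Fixpoint lommel (R : realType) (nu : R) (n : nat) : {poly R} :=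
  match n with
  | 0 => 1
  | 1 => (2^-1)%:P
  | (k.+1 as m).+1 => lommel nu m - beta_coef nu m *: ('X * lommel nu k)
  end.

Section Lommel.
Variables (R : realType) (nu : R).
Hypothesis nu_gt0 : 0 < nu.

Lemma beta_gt0 n : 0 < beta_coef nu n.+1.
Proof.
rewrite /beta_coef divr_gt0// !mulr_gt0//; last first.
  by rewrite ltr_wpDr.
by rewrite -natr1 addrA addrK ltr_wpDr.
Qed.

Lemma lommelSS n : lommel nu n.+2 =
  lommel nu n.+1 - beta_coef nu n.+1 *: ('X * lommel nu n).
Proof. by []. Qed.

Lemma coef_lommelSS n i : (lommel nu n.+2)`_i.+1 =
  (lommel nu n.+1)`_i.+1 - beta_coef nu n.+1 * (lommel nu n)`_i.
Proof. by rewrite lommelSS coefB coefZ coefXM. Qed.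

Lemma lommel_coef0 n : (lommel nu n.+1)`_0 = 2^-1.
Proof.
elim: n => [|n IH]; first by rewrite coefC.
by rewrite lommelSS coefB coefZ coefXM mulr0 subr0.
Qed.

Lemma size_lommel_le n : (size (lommel nu n) <= (n./2).+1)%N.
Proof.
suff: (size (lommel nu n) <= (n./2).+1)%N /\
      (size (lommel nu n.+1) <= (n.+1./2).+1)%N by case.
elim: n => [|n [IH1 IH2]]; first by rewrite size_polyC oner_eq0 size_polyC_leq1.
split=> //; rewrite lommelSS; apply: (leq_trans (size_polyD _ _)).
rewrite geq_max size_polyN; apply/andP; split.
  by apply: (leq_trans IH2); rewrite ltnS /= uphalf_half; case: (odd n) => //=; lia.
apply: (leq_trans (size_scale_leq _ _)); apply: (leq_trans (size_polyMleq _ _)).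
by rewrite size_polyX /= ltnS.
Qed.

(** Both terms of the recurrence contribute to a coefficient with the same sign, so nothing cancels.
    This fixes the exact degree and the sign of the leading coefficient. *)
Lemma lommel_coef_sign n i : (i <= n./2)%N -> 0 < (-1) ^+ i * (lommel nu n)`_i.
Proof.
suff: (forall i, (i <= n./2)%N -> 0 < (-1) ^+ i * (lommel nu n)`_i) /\
      (forall i, (i <= n.+1./2)%N -> 0 < (-1) ^+ i * (lommel nu n.+1)`_i).
  by case=> + _; apply.
elim: n {i} => [|n [IH1 IH2]].
  by split=> -[|i]//= _; rewrite expr0 mul1r coefC.
split=> // -[|i] hi; first by rewrite expr0 mul1r lommel_coef0 invr_gt0.
rewrite coef_lommelSS exprS.
have h1 : 0 < (-1) ^+ i * (lommel nu n)`_i by apply: IH1.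
have h2 : 0 <= (-1) ^+ i.+1 * (lommel nu n.+1)`_i.+1.
  case: (leqP i.+1 (n.+1./2)) => hi'; first exact/ltW/IH2.
  by rewrite nth_default ?mulr0// (leq_trans (size_lommel_le _)).
move: h2 (mulr_gt0 (beta_gt0 n) h1); rewrite exprS; lra.
Qed.

Lemma size_lommel n : size (lommel nu n) = (n./2).+1.
Proof.
apply/eqP; rewrite eqn_leq size_lommel_le ltnNge; apply/negP => h.
by have := lommel_coef_sign (leqnn n./2); rewrite nth_default// mulr0 ltxx.
Qed.

Lemma lommel_lead_sign n : 0 < (-1) ^+ (n./2) * lead_coef (lommel nu n).
Proof. by rewrite /lead_coef size_lommel lommel_coef_sign. Qed.

Lemma horner_prod_linear (y : nat -> R) d x :
  (\prod_(i < d) (1 - y i *: 'X)).[x] = \prod_(i < d) (1 - y i * x).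
Proof.
by rewrite horner_prod; apply: eq_bigr => i _; rewrite !hornerE.
Qed.

(** The first [i] factors are negative and the others positive. It gives the sign of a polynomial at
    a point that separates its roots. *)
Lemma prod_linear_sign (y : nat -> R) d i u : (i <= d)%N ->
  (forall j, (j < i)%N -> 1 < y j * u) ->
  (forall j, (i <= j < d)%N -> y j * u < 1) ->
  0 < (-1) ^+ i * \prod_(j < d) (1 - y j * u).
Proof.
move=> id h1 h2.
rewrite -(big_mkord xpredT (fun j => 1 - y j * u)) (big_cat_nat _ id)//= mulrA.
apply: mulr_gt0; last first.
  rewrite big_nat; apply: prodr_gt0 => j /h2; lra.
rewrite big_mkord -[i in (-1) ^+ i]card_ord -prodrN.
by apply: prodr_gt0 => j _; have := h1 _ (ltn_ord j); lra.
Qed.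

(* The [y i] are the reciprocals of the roots of [lommel nu n.+1], in decreasing
   order and padded with zeros. *)
Record lommel_roots (n : nat) (y : nat -> R) : Prop := LommelRoots {
  lommel_roots_gt0 : forall i, (i < n.+1./2)%N -> 0 < y i;
  lommel_roots_eq0 : forall i, (n.+1./2 <= i)%N -> y i = 0;
  lommel_roots_decr : forall i, (i.+1 < n.+1./2)%N -> y i.+1 < y i;
  lommel_roots_prod :
    lommel nu n.+1 = 2^-1 *: \prod_(i < n.+1./2) (1 - y i *: 'X);
  lommel_roots_sign : forall i, (i < n.+1./2)%N ->
    0 < (-1) ^+ i * (lommel nu n).[(y i)^-1] }.

Lemma lommel_roots_base : lommel_roots 0 (fun=> 0).
Proof.
by split => //=; rewrite big_ord0 alg_polyC.
Qed.

(* Interlacing: at the reciprocals of the y_i the polynomial alternates in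
   sign, so that each gap between consecutive ones (and 0, and infinity when
   the degree goes up) contains a root of the next polynomial. *)
Lemma lommel_roots_step n y : lommel_roots n y ->
  exists2 z, lommel_roots n.+1 z & forall i, y i <= z i.
Proof.
case=> y_gt0 y_eq0 y_decr Ry Rsign.
set d := n.+1./2 in y_gt0 y_eq0 y_decr Ry Rsign *.
set d' := n.+2./2.
have dd' : (d <= d' <= d.+1)%N by rewrite /d /d'; lia.
set P := lommel nu n.+2.
have y_lt i j : (i < j < d)%N -> y j < y i.
  elim: j => // j IH /andP[]; rewrite ltnS leq_eqVlt => /orP[/eqP->|ij] jd.
    exact: y_decr.
  by apply: lt_trans (y_decr _ jd) (IH _); rewrite ij/= ltnW.
have RProot i : (i < d)%N -> (lommel nu n.+1).[(y i)^-1] = 0.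
  move=> id; rewrite Ry hornerZ horner_prod_linear (bigD1 (Ordinal id))//=.
  by rewrite mulfV ?subrr ?mul0r ?mulr0// gt_eqF// y_gt0.
have Psign i : (i < d)%N -> (-1) ^+ i * P.[(y i)^-1] < 0.
  move=> id; rewrite /P lommelSS hornerD hornerN hornerZ hornerM hornerX RProot//.
  rewrite add0r mulrN oppr_lt0.
  have -> (a b c e : R) : a * (b * (c * e)) = b * c * (a * e) by ring.
  by apply: mulr_gt0 (Rsign _ id); rewrite mulr_gt0 ?beta_gt0 ?invr_gt0 ?y_gt0.
have P0 : P.[0] = 2^-1 by rewrite horner_coef0 lommel_coef0.
(* [l i] is the left end of the gap in which the [i]-th root of [P] is sought; the right end is
   [h i] below. *)
pose l i : R := if i is k.+1 then (y k)^-1 else 0.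
have lsign i : (i <= d)%N -> 0 < (-1) ^+ i * P.[l i].
  case: i => [|i] id /=; first by rewrite expr0 mul1r P0 invr_gt0.
  by rewrite exprS mulN1r mulNr oppr_gt0 Psign.
(* [M] closes the last gap when the degree goes up: it lies so far to the right that [P] has the
   sign of its leading coefficient. *)
have [M Md Msign] : exists2 M : R, l d < M & (-1) ^+ d' * P.[M] > 0.
  have [|M M2] := @poly_pinfty_gt_lc R ((-1) ^+ d' *: P).
    by rewrite lead_coefZ lommel_lead_sign.
  exists (Num.max M (l d + 1)); first by rewrite lt_max; apply/orP; right; lra.
  rewrite -hornerZ; apply: lt_le_trans (M2 _ _); last by rewrite le_max lexx.
  by rewrite lead_coefZ lommel_lead_sign.
pose h i : R := if (i < d)%N then (y i)^-1 else M.
have hl i : (i < d)%N -> h i = l i.+1 by rewrite /h => ->.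
have ilt i : (i < d')%N -> l i < h i.
  move=> id'; rewrite /h; case: ifP => [id|id].
    case: i id id' => [|i] id id' /=; first by rewrite invr_gt0 y_gt0.
    by rewrite ltf_pV2 ?posrE ?y_gt0 ?y_decr// ltnW.
  by have -> : i = d by move: dd'; lia.
have hsign i : (i < d')%N -> (-1) ^+ i * P.[h i] < 0.
  move=> id'; rewrite /h; case: ifP => [id|id]; first exact: Psign.
  have di : d' = i.+1 by move: dd'; lia.
  by move: Msign; rewrite di exprS mulN1r mulNr oppr_gt0.
have /choice[u hu] : forall i, exists u, (i < d')%N -> [/\ l i < u, u < h i & root P u].
  move=> i; case: (ltnP i d') => id'; last by exists 0.
  have : P.[l i] * P.[h i] < 0.
    have id : (i <= d)%N by move: dd'; lia.
    have h1 := lsign _ id; have h2 := hsign _ id'.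
    have := nmulr_rlt0 ((-1) ^+ i * P.[l i]) h2; rewrite h1.
    rewrite mulrACA -expr2 sqrr_sign mul1r [_ * P.[h i]]mulrC.
    by rewrite mulrC.
  by move=> /(poly_ivtoo (ltW (ilt _ id')))[u]; rewrite in_itv/= => /andP[u1 u2] ru; exists u.
have u_gt0 i : (i < d')%N -> 0 < u i.
  move=> id'; have [h1 _ _] := hu _ id'; apply: le_lt_trans h1.
  by case: i id' => //= i id'; rewrite invr_ge0 ltW// y_gt0//; move: dd'; lia.
have u_incr i j : (i < j < d')%N -> u i < u j.
  elim: j => // j IH /andP[]; rewrite ltnS => ij jd'.
  have jj : u j < u j.+1.
    have [_ h1 _] := hu _ (ltnW jd'); have [h2 _ _] := hu _ jd'.
    by apply: (lt_trans h1); rewrite hl//; move: dd'; lia.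
  move: ij; rewrite leq_eqVlt => /orP[/eqP->//|ij].
  by apply: lt_trans jj; apply: IH; rewrite ij/= ltnW.
pose z i := if (i < d')%N then (u i)^-1 else 0.
have zE i : (i < d')%N -> z i = (u i)^-1 by rewrite /z => ->.
exists z; last first.
  move=> i; case: (ltnP i d) => id; last first.
    rewrite y_eq0// /z; case: ifP => // id'; by rewrite invr_ge0 ltW// u_gt0.
  have id' : (i < d')%N by move: dd'; lia.
  have [_ h1 _] := hu _ id'; rewrite zE// -[y i]invrK lef_pV2 ?posrE ?invr_gt0 ?y_gt0 ?u_gt0//.
  by apply: ltW; move: h1; rewrite /h id.
split => [i id'|i id'|i id'||i id'].
- by rewrite zE// invr_gt0 u_gt0.
- by rewrite /z ltnNge id'.
- by rewrite !zE ?(ltnW id')// ltf_pV2 ?posrE ?u_gt0 ?u_incr ?ltnSn ?(ltnW id')//=.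
(* The [d'] distinct roots exhaust the degree of [P]; its value at 0 then determines the scalar
   factor. *)
- have := @all_roots_prod_XsubC _ P (mkseq u d').
  rewrite size_lommel size_mkseq => /(_ erefl) PE.
  have {}PE : P = lead_coef P *: \prod_(i < d') ('X - (u i)%:P).
    rewrite {1}PE; last first.
    + rewrite uniq_rootsE; apply/mkseq_uniqP => i j; rewrite !inE => id jd uij.
      have [ij|ij|//] := ltngtP i j.
        by have := @u_incr i j; rewrite ij jd uij ltxx => /(_ isT).
      by have := @u_incr j i; rewrite ij id uij ltxx => /(_ isT).
    + by apply/allP => x /mapP[i]; rewrite mem_iota/= => id ->; case: (hu _ id).
    by rewrite /mkseq big_map -{1}[d']subn0 -/(index_iota _ _) big_mkord.
  have [c PE'] : exists c, P = c *: \prod_(i < d') (1 - z i *: 'X).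
    exists (lead_coef P * \prod_(i < d') (- u i)); rewrite {1}PE -scalerA -scaler_prod; congr (_ *: _); apply: eq_bigr => i _.
    rewrite zE// scalerBr scalerA mulNr mulfV ?gt_eqF ?u_gt0// scaleN1r opprK.
    by rewrite alg_polyC polyCN addrC.
  rewrite -/P PE'; congr (_ *: _).
  have := P0; rewrite PE' hornerZ horner_prod_linear.
  by rewrite [\prod_(i < d') (1 - _)]big1 ?mulr1// => i _; rewrite mulr0 subr0.
(* Exactly [i] of the numbers [(y j)^-1] lie to the left of [u i]. *)
- have [h1 h2 _] := hu _ id'.
  rewrite zE// invrK Ry hornerZ horner_prod_linear mulrCA mulr_gt0 ?invr_gt0//.
  apply: prod_linear_sign => [|j ji|j /andP[ij jd]]; first by move: dd'; lia.
    have jd : (j < d)%N by move: dd'; lia.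
    rewrite -ltr_pdivrMl ?y_gt0// mulr1; apply: le_lt_trans h1.
    case: i id' h2 ji => // i id' h2; rewrite ltnS leq_eqVlt => /orP[/eqP->//|ji] /=.
    by rewrite lef_pV2 ?posrE ?y_gt0 ?(ltW (y_lt _ _ _))//; move: dd'; lia.
  rewrite -ltr_pdivlMl ?y_gt0// mulr1; apply: lt_le_trans h2 _.
  rewrite /h (leq_ltn_trans ij jd).
  move: ij; rewrite leq_eqVlt => /orP[/eqP->//|ij].
  by rewrite lef_pV2 ?posrE ?y_gt0 ?(ltW (y_lt _ _ _)) ?ij//; move: dd'; lia.
Qed.

(** The comparison in [lommel_roots_step] is relative to the list it starts from, so the lists are
    chosen coherently by dependent choice on pairs of an index and a list. *)
Lemma lommel_roots_exist : exists y : nat -> nat -> R,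
  (forall n, lommel_roots n (y n)) /\ (forall n i, y n i <= y n.+1 i).
Proof.
pose T := {ny : nat * (nat -> R) | lommel_roots ny.1 ny.2}.
pose rel (a b : T) := (sval b).1 = (sval a).1.+1 /\
  forall i, (sval a).2 i <= (sval b).2 i.
have [] := @dependent_choice T rel _
  (exist (fun ny : nat * (nat -> R) => lommel_roots ny.1 ny.2) (0%N, fun=> 0 : R)
     lommel_roots_base).
  move=> [[n y] /= yr]; have [z zr yz] := cid2 (lommel_roots_step yr).
  by exists (exist (fun ny : nat * (nat -> R) => lommel_roots ny.1 ny.2) (n.+1, z) zr).
move=> f [f0 fS].
have fn n : (sval (f n)).1 = n.
  by elim: n => [|n IH]; [rewrite f0|have [-> _] := fS n; rewrite IH].
exists (fun n => (sval (f n)).2); split => n; last by have [] := fS n.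
by have := svalP (f n); rewrite fn.
Qed.

End Lommel.

(** * Normalized Bessel functions *)

Section Series.
Local Open Scope classical_set_scope.
Variables (R : realType) (nu : R).
Hypothesis nu_gt0 : 0 < nu.

Definition rising (a : R) (m : nat) : R := \prod_(i < m) (a + i%:R).

Lemma risingSr a m : rising a m.+1 = rising a m * (a + m%:R).
Proof. by rewrite /rising big_ord_recr. Qed.

Lemma risingSl a m : rising a m.+1 = a * rising (a + 1) m.
Proof.
rewrite /rising big_ord_recl addr0; congr (_ * _); apply: eq_bigr => i _.
by rewrite lift0 -natr1 -addrA [1 + _]addrC.
Qed.

Lemma rising_ge a m : 0 < a -> a ^+ m <= rising a m.
Proof.
move=> a0; rewrite -[m in leLHS]card_ord -prodr_const; apply: ler_prod => i _.
by rewrite ltW//= lerDl.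
Qed.

Lemma rising_gt0 a m : 0 < a -> 0 < rising a m.
Proof. by move=> a0; apply: lt_le_trans (rising_ge m a0); rewrite exprn_gt0. Qed.

(** The coefficients of the hypergeometric series [0F1(; nu + n + 1; - s / 4)]. *)
Definition bessel_coef (n m : nat) : R :=
  (- 4^-1) ^+ m / (m`!%:R * rising (nu + n.+1%:R) m).

(* J_{nu+n}(z) = (z/2)^(nu+n) / Gamma(nu+n+1) * bessel_fun n (z^2) *)
Definition bessel_fun (n : nat) (s : R) : R := limn (pseries (bessel_coef n) s).

Lemma nuS_gt0 n : 0 < nu + n%:R.
Proof. by rewrite ltr_wpDr. Qed.

Lemma bessel_coef0 n : bessel_coef n 0 = 1.
Proof. by rewrite /bessel_coef expr0 /rising big_ord0 mulr1 invr1 mulr1. Qed.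

(** The coefficient form of [J_{mu-1} + J_{mu+1} = (2 mu / z) J_mu] for [mu = nu + n + 1]. *)
Lemma bessel_coef_rec n m : bessel_coef n m.+1 =
  bessel_coef n.+1 m.+1 - beta_coef nu n.+2 * bessel_coef n.+2 m.
Proof.
have a0 := nuS_gt0 n.+1; set a := nu + n.+1%:R in a0.
have aE : nu + n.+2%:R = a + 1 by rewrite /a -[n.+2%:R]natr1 addrA.
have aE' : nu + n.+3%:R = a + 1 + 1 by rewrite -aE -[n.+3%:R]natr1 addrA.
rewrite /bessel_coef /beta_coef aE aE' -/a addrK.
have Q0 : 0 < rising (a + 1 + 1) m by rewrite rising_gt0// !ltr_wpDr.
have ES : rising (a + 1) m.+1 = (a + 1) * rising (a + 1 + 1) m by exact: risingSl.
have m0 : (0 : R) <= m%:R by [].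
have E : rising a m.+1 = a * (a + 1) * rising (a + 1 + 1) m / (a + 1 + m%:R).
  apply: (mulIf (_ : a + 1 + m%:R != 0)); first by rewrite gt_eqF// !ltr_wpDr.
  rewrite mulfVK ?gt_eqF ?ltr_wpDr//.
  by rewrite risingSl -[LHS]mulrA -(risingSr (a + 1) m) ES mulrA.
have f0 : (0 : R) < m`!%:R by rewrite ltr0n fact_gt0.
rewrite E ES factS natrM exprS -natr1.
set Q := rising _ _ in Q0 *; set c := _ ^+ m; field.
by rewrite !gt_eqF//; lra.
Qed.

(** By [rising_ge]. The argument of the dominating exponential series tends to 0 as [n] grows, which
    yields not only convergence but also [b_n -> 1]. *)
Lemma bessel_coef_norm n m s : `|bessel_coef n m * s ^+ m| <=
  exp_coeff (`|s| / (4 * (nu + n.+1%:R))) m.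
Proof.
have a0 := nuS_gt0 n.+1.
have f0 : (0 : R) < m`!%:R by rewrite ltr0n fact_gt0.
have r0 := rising_gt0 m a0.
rewrite /bessel_coef /exp_coeff /= normrM normf_div !normrX normrN.
rewrite (gtr0_norm (mulr_gt0 f0 r0)) [`|4^-1|]gtr0_norm ?invr_gt0//.
set r := rising _ _ in r0 *; set a := nu + _ in a0 *; set f := _%:R in f0 *.
have -> : 4^-1 ^+ m / (f * r) * `|s| ^+ m = 4^-1 ^+ m / f * `|s| ^+ m * r^-1.
  by field; rewrite !gt_eqF.
have -> : (`|s| / (4 * a)) ^+ m / f = 4^-1 ^+ m / f * `|s| ^+ m * (a ^+ m)^-1.
  by rewrite invfM !exprMn !exprVn; field; rewrite !gt_eqF ?exprn_gt0.
rewrite ler_wpM2l//; first by rewrite !mulr_ge0 ?exprn_ge0 ?invr_ge0// ltW.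
by rewrite lef_pV2 ?posrE ?exprn_gt0// rising_ge.
Qed.

Lemma bessel_fun_is_cvg n s : cvgn (pseries (bessel_coef n) s).
Proof.
apply: normed_cvg; apply: (@series_le_cvg _ _
  (exp_coeff (`|s| / (4 * (nu + n.+1%:R))))) => [//|m|m|].
- by move=> m /=.
- by rewrite exp_coeff_ge0// divr_ge0// mulr_ge0// ltW ?nuS_gt0.
- exact: bessel_coef_norm.
- exact: is_cvg_series_exp_coeff.
Qed.

Lemma bessel_fun_cvg n s : pseries (bessel_coef n) s @ \oo --> bessel_fun n s.
Proof. exact: bessel_fun_is_cvg. Qed.

Lemma bessel_fun_near1 n s :
  `|bessel_fun n s - 1| <= expR (`|s| / (4 * (nu + n.+1%:R))) - 1.
Proof.
set e := _ / _.
have e0 : 0 <= e by rewrite divr_ge0// mulr_ge0// ltW ?nuS_gt0.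
have cb : (fun k => `|pseries (bessel_coef n) s k.+1 - 1|) @ \oo --> `|bessel_fun n s - 1|.
  apply: cvg_norm; apply: cvgB; last exact: cvg_cst.
  by rewrite (@cvg_shiftS _ (pseries (bessel_coef n) s)); exact: bessel_fun_cvg.
apply: (cvgr_to_le cb); apply: nearW => k.
rewrite /pseries seriesEnat/= big_nat_recl// bessel_coef0 expr0 mulr1 addrC addKr.
apply: (le_trans (ler_norm_sum _ _ _)); rewrite lerBrDl.
apply: (@le_trans _ _ (series (exp_coeff e) k.+1)).
  rewrite seriesEnat/= big_nat_recl// {1}/exp_coeff/= expr0 fact0 divr1 lerD2l.
  by apply: ler_sum => i _; exact: bessel_coef_norm.
apply: nondecreasing_cvgn_le; last exact: is_cvg_series_exp_coeff.
by apply/nondecreasing_seqP => i; rewrite seriesSr lerDl exp_coeff_ge0.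
Qed.

Lemma inv_nu_cvg0 (c : R) k : c / (4 * (nu + (n + k.+1)%:R)) @[n --> \oo] --> (0 : R).
Proof.
have -> : (fun n => c / (4 * (nu + (n + k.+1)%:R))) =
    (fun n => c / 4 * (nu + (n + k.+1)%:R)^-1).
  by apply/funext => n; rewrite invfM mulrA.
rewrite -[X in _ --> X](mulr0 (c / 4)); apply: cvgMr.
apply: (squeeze_cvgr _ (cvg_cst 0) (@cvg_harmonic R)); apply: nearW => n /=.
rewrite invr_ge0 ltW ?nuS_gt0//= lef_pV2 ?posrE ?nuS_gt0//.
by apply: ler_wpDl; [exact: ltW|rewrite ler_nat addnS ltnS leq_addr].
Qed.

Lemma bessel_fun_cvg1 k s : bessel_fun (n + k) s @[n --> \oo] --> (1 : R).
Proof.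
apply/subr_cvg0/norm_cvg0P.
have : expR (`|s| / (4 * (nu + (n + k.+1)%:R))) - 1 @[n --> \oo] --> (expR 0 - 1 : R).
  apply: cvgB; last exact: cvg_cst.
  apply: continuous_cvg; first exact: continuous_expR.
  exact: inv_nu_cvg0.
rewrite expR0 subrr => h; apply: (squeeze_cvgr _ (cvg_cst 0) h).
by apply: nearW => n /=; rewrite normr_ge0/= addnS bessel_fun_near1.
Qed.

Lemma bessel_fun_rec n s : bessel_fun n s =
  bessel_fun n.+1 s - beta_coef nu n.+2 * s * bessel_fun n.+2 s.
Proof.
have h1 : (fun k => pseries (bessel_coef n) s k.+1) @ \oo --> bessel_fun n s.
  by rewrite (@cvg_shiftS _ (pseries (bessel_coef n) s)); exact: bessel_fun_cvg.
have h2 : (fun k => pseries (bessel_coef n.+1) s k.+1) @ \oo --> bessel_fun n.+1 s.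
  by rewrite (@cvg_shiftS _ (pseries (bessel_coef n.+1) s)); exact: bessel_fun_cvg.
have h3 : (fun k => beta_coef nu n.+2 * s * pseries (bessel_coef n.+2) s k) @ \oo
    --> beta_coef nu n.+2 * s * bessel_fun n.+2 s.
  by apply: cvgMr; exact: bessel_fun_cvg.
have E : (fun k => pseries (bessel_coef n) s k.+1) =
    (fun k => pseries (bessel_coef n.+1) s k.+1 -
      beta_coef nu n.+2 * s * pseries (bessel_coef n.+2) s k).
  apply/funext => k; rewrite /pseries !seriesEnat/= !big_nat_recl// !bessel_coef0.
  rewrite -addrA; congr (_ + _); rewrite mulr_sumr -sumrB; apply: eq_bigr => i _.
  by rewrite bessel_coef_rec exprS; ring.
by apply: (cvg_unique _ h1) => //; rewrite E; exact: cvgB.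
Qed.

Lemma bessel_coef_diffs n : pseries_diffs (bessel_coef n) =
  (- (4 * (nu + n.+1%:R))^-1) *: bessel_coef n.+1.
Proof.
apply/funext => m; rewrite /pseries_diffs fctE /bessel_coef risingSl factS natrM exprS.
have a0 := nuS_gt0 n.+1; have -> : nu + n.+2%:R = nu + n.+1%:R + 1 :> R.
  by rewrite -[n.+2%:R]natr1 addrA.
have f0 : (0 : R) < m`!%:R by rewrite ltr0n fact_gt0.
have r0 : 0 < rising (nu + n.+1%:R + 1) m by rewrite rising_gt0// ltr_wpDr.
set a := nu + _ in a0 *; set Q := rising _ _ in r0 *.
rewrite /GRing.scale/=; set c := _ ^+ m; field.
by rewrite !gt_eqF.
Qed.

Lemma pseriesZ (c : R) (f : R ^nat) s : pseries (c *: f) s = c *: pseries f s.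
Proof.
rewrite /pseries -seriesZ; congr series; apply/funext => i.
by rewrite fctE [RHS]/GRing.scale/= -mulrA.
Qed.

(** Termwise differentiation; in the variable [z] this is [(z^(-mu) J_mu)' = - z^(-mu) J_{mu+1}]
    with [mu = nu + n]. *)
Lemma is_derive_bessel_fun n (s : R) : is_derive s (1 : R) (bessel_fun n)
  (- (4 * (nu + n.+1%:R))^-1 * bessel_fun n.+1 s).
Proof.
have cZ k c t : cvgn (pseries (c *: bessel_coef k) t).
  by rewrite pseriesZ; apply: is_cvgZl_tmp; exact: bessel_fun_is_cvg.
have diffsZ c k : pseries_diffs (c *: bessel_coef k) = c *: pseries_diffs (bessel_coef k).
  by apply/funext => i; rewrite /pseries_diffs !fctE /GRing.scale/= mulrCA.
have := @pseries_snd_diffs R (bessel_coef n) (`|s| + 1) s.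
rewrite bessel_coef_diffs diffsZ bessel_coef_diffs scalerA => H.
apply: is_derive_eq (H _ _ _ _) _.
- exact: bessel_fun_is_cvg.
- exact: cZ.
- exact: cZ.
- by rewrite [ltRHS]gtr0_norm ?ltrDl// ltr_wpDl.
- rewrite pseriesZ; apply/cvg_lim => //.
  have H1 : (fun k => - (4 * (nu + n.+1%:R))^-1 * pseries (bessel_coef n.+1) s k) @ \oo
      --> - (4 * (nu + n.+1%:R))^-1 * bessel_fun n.+1 s.
    by apply: cvgMr; exact: bessel_fun_cvg.
  exact: H1.
Qed.

End Series.

(** * The limit of the reversed polynomials *)

Section Limit.
Local Open Scope classical_set_scope.
Variables (R : realType) (nu : R).
Hypothesis nu_gt0 : 0 < nu.
Notation r n s := (lommel nu n).[s].
Notation b := (bessel_fun nu).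
Notation beta := (beta_coef nu).

(** This is [z J'_nu = nu J_nu - z J_{nu+1}] divided by [2 nu] times the leading term of [J_nu],
    with [s = z^2]. *)
Definition bessel_prime (s : R) : R := b 0 s / 2 - beta 1 * s * b 1 s.
Notation G := bessel_prime.

Lemma betaSE n : beta n.+1 = (4 * (nu + n%:R) * (nu + n.+1%:R))^-1.
Proof. by rewrite /beta_coef -[n.+1%:R]natr1 addrA addrK div1r. Qed.

Lemma beta1E : beta 1 = (4 * nu * (nu + 1))^-1.
Proof. by rewrite /beta_coef addrK div1r. Qed.

Lemma beta2E : beta 2 = (4 * (nu + 1) * (nu + 2))^-1.
Proof. by rewrite /beta_coef div1r -[2%:R]natr1 addrA addrK -addrA. Qed.

Lemma horner_lommelSS n s : r n.+2 s = r n.+1 s - beta n.+1 * s * r n s.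
Proof. by rewrite lommelSS hornerD hornerN hornerZ hornerM hornerX mulrA. Qed.

(** [lommel] obeys the recurrence upwards and [b] obeys it downwards, so the step from [n] to [n.+1]
    changes nothing; at [n = 0] this is the definition of [G]. *)
Lemma lommel_casoratian n s :
  r n.+1 s * b n s - beta n.+1 * s * r n s * b n.+1 s = G s.
Proof.
elim: n => [|n <-].
  by rewrite /= !hornerE /bessel_prime mulrC.
by rewrite horner_lommelSS (bessel_fun_rec nu_gt0 n); ring.
Qed.

Lemma beta_diff n : beta n.+1 = 4^-1 * ((nu + n%:R)^-1 - (nu + n.+1%:R)^-1).
Proof.
have h := nuS_gt0 nu_gt0; have h1 := h n; have h2 := h n.+1.
rewrite /beta_coef -[n.+1%:R]natr1 addrA addrK; rewrite -[n.+1%:R]natr1 addrA in h2.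
by set a := nu + _ in h1 h2 *; field; rewrite !gt_eqF.
Qed.

Lemma lommel_bounded s : exists2 C : R, 0 < C & forall n, `|r n s| <= C.
Proof.
(* By [beta_diff], which makes the sum telescope, this is the exponential of
   [|s| * (beta 1 + ... + beta n)]. *)
pose M n : R := expR (`|s| / 4 * (nu^-1 - (nu + n%:R)^-1)).
have MS n : M n * (1 + beta n.+1 * `|s|) <= M n.+1.
  rewrite /M; apply: le_trans (ler_wpM2l (expR_ge0 _) (expR_ge1Dx _)) _.
  rewrite -expRD ler_expR beta_diff.
  set x := nu^-1; set y := (nu + n%:R)^-1; set z := (nu + n.+1%:R)^-1.
  by rewrite le_eqVlt; apply/orP; left; apply/eqP; field.
have Mle n : M n <= M n.+1.
  apply: le_trans (MS n); rewrite ler_peMr ?expR_ge0// lerDl mulr_ge0//.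
  by rewrite ltW// beta_gt0.
have H n : `|r n s| <= M n /\ `|r n.+1 s| <= M n.
  elim: n => [|n [IH1 IH2]].
    rewrite /M addr0 subrr mulr0 expR0 /= !hornerE normr1; split => //.
    by rewrite ger0_norm ?invr_ge0// invf_le1// ler1n.
  split; first exact: le_trans IH2 (Mle n).
  rewrite horner_lommelSS; apply: le_trans (MS n); apply: le_trans (ler_normB _ _) _.
  rewrite mulrDr mulr1 lerD// 2!normrM (gtr0_norm (beta_gt0 nu_gt0 n)).
  by rewrite [leLHS]mulrC ler_wpM2r// mulr_ge0// ltW// beta_gt0.
exists (expR (`|s| / 4 * nu^-1)); first exact: expR_gt0.
move=> n; apply: le_trans (H n).1 _; rewrite ler_expR ler_wpM2l ?divr_ge0//.
by rewrite gerBl invr_ge0 ltW// nuS_gt0.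
Qed.

Lemma beta_cvg0 : beta n.+1 @[n --> \oo] --> (0 : R).
Proof.
have := @inv_nu_cvg0 R nu nu_gt0 nu^-1 0.
move=> h; apply: (squeeze_cvgr _ (cvg_cst 0) h); apply: nearW => n /=.
have h1 := nuS_gt0 nu_gt0 n; have h2 := nuS_gt0 nu_gt0 n.+1.
rewrite ltW ?beta_gt0//= betaSE addn1 !invfM [leRHS]mulrA [_ / 4]mulrC.
rewrite ler_wpM2r ?invr_ge0 ?(ltW h2)// ler_wpM2l ?invr_ge0//.
by rewrite lef_pV2 ?posrE// lerDl.
Qed.

(** Solve the Casoratian identity for [r n.+1 s]: the other term vanishes in the limit because
    [beta] tends to 0 against bounded factors, and the divisor [b n s] tends to 1. *)
Lemma lommel_cvg s : r n s @[n --> \oo] --> G s.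
Proof.
have [C C0 hC] := lommel_bounded s.
have b1 k : b (n + k) s @[n --> \oo] --> (1 : R) by exact: bessel_fun_cvg1.
have h1 : beta n.+1 * s * r n s * b n.+1 s @[n --> \oo] --> (0 : R).
  have h2 : beta n.+1 * (`|s| * C) * `|b (n + 1) s| @[n --> \oo] --> 0 * (`|s| * C) * `|1 : R|.
    apply: cvgM; last exact: cvg_norm.
    by apply: cvgM beta_cvg0 _; exact: cvg_cst.
  apply/norm_cvg0P; rewrite !mul0r in h2; apply: (squeeze_cvgr _ (cvg_cst 0) h2).
  apply: nearW => n /=; rewrite normr_ge0/= 3!normrM addn1 (gtr0_norm (beta_gt0 nu_gt0 n)).
  by rewrite ler_wpM2r// -mulrA ler_wpM2l ?ler_wpM2l// ltW// beta_gt0.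
have h3 : (G s + beta n.+1 * s * r n s * b n.+1 s) / b (n + 0) s @[n --> \oo]
    --> (G s + 0) / 1.
  apply: cvgM; first by apply: cvgD h1; exact: cvg_cst.
  by apply: cvgV => //; exact: oner_neq0.
rewrite addr0 divr1 in h3; rewrite -cvg_shiftS; apply: cvg_trans h3.
apply: near_eq_cvg; have : \forall n \near \oo, b (n + 0) s > 0.
  by apply: (cvgr_gt _ (b1 0)); exact: ltr01.
apply: filterS => n; rewrite addn0 => bn.
by rewrite -(lommel_casoratian n) subrK mulfK// gt_eqF.
Qed.

(* At [s = nu^2] the recurrence reads
   F_{n+1} - F_n = (F_n - F_{n-1}) + 2 n F_n / nu with F_0 = F_1 = 1, after
   rescaling [r n] to F_n. *)
Lemma lommel_nu2 n : 0 < r n (nu ^+ 2) /\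
  nu / (2 * (nu + n%:R)) * r n (nu ^+ 2) <= r n.+1 (nu ^+ 2).
Proof.
elim: n => [|n [IH1 IH2]].
  rewrite /= !hornerE; split => //.
  by rewrite le_eqVlt; apply/orP; left; apply/eqP; field; rewrite gt_eqF// addr0.
have h := nuS_gt0 nu_gt0; have h1 := h n; have h2 := h n.+1.
have n0 : (0 : R) <= n%:R by [].
have r1 : 0 < r n.+1 (nu ^+ 2).
  by apply: lt_le_trans IH2; rewrite mulr_gt0// divr_gt0// mulr_gt0.
split => //; rewrite horner_lommelSS.
have E : beta n.+1 * nu ^+ 2 * r n (nu ^+ 2) <=
    nu / (2 * (nu + n.+1%:R)) * r n.+1 (nu ^+ 2).
  apply: le_trans (ler_wpM2l _ IH2); last by rewrite divr_ge0 ?mulr_ge0// ltW.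
  rewrite /beta_coef -[n.+1%:R]natr1 addrA addrK; rewrite -[n.+1%:R]natr1 addrA in h2.
  set a := nu + _ in h1 h2 *; rewrite le_eqVlt; apply/orP; left; apply/eqP.
  by field; rewrite !gt_eqF.
have E2 : nu / (2 * (nu + n.+1%:R)) <= 2^-1.
  rewrite ler_pdivrMr ?mulr_gt0// mulrA mulVf// mul1r lerDl ler0n//.
set x := nu / _ in E E2 *; set y := r n.+1 _ in E r1 *.
have : x * y <= 2^-1 * y by rewrite ler_wpM2r// ltW.
lra.
Qed.

(** Otherwise the Casoratian identity and [lommel_nu2] would give [b n <= b n.+1 / 2] at [nu ^+ 2]
    for all large [n], against [b n -> 1]. The point matters because a zero of [G] there would be
    multiple. *)
Lemma bessel_prime_nu2_neq0 : G (nu ^+ 2) != 0.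
Proof.
apply/eqP => G0.
have b1 k : b (n + k) (nu ^+ 2) @[n --> \oo] --> (1 : R) by exact: bessel_fun_cvg1.
have : (1 : R) <= 2^-1 * 1.
  have h1 := b1 0; have h2 : 2^-1 * b (n + 1) (nu ^+ 2) @[n --> \oo] --> (2^-1 * 1 : R).
    by apply: cvgMr; exact: b1.
  apply: (ler_cvg_to h1 h2).
  have : \forall n \near \oo, b (n + 0) (nu ^+ 2) > 0.
    by apply: (cvgr_gt _ (b1 0)); exact: ltr01.
  have : \forall n \near \oo, b (n + 1) (nu ^+ 2) > 0.
    by apply: (cvgr_gt _ (b1 1)); exact: ltr01.
  apply: filterS2 => n; rewrite addn0 addn1 => p1 p0.
  have [rn0 rn1] := lommel_nu2 n.
  have := lommel_casoratian n (nu ^+ 2); rewrite G0 => /subr0_eq E.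
  have h := nuS_gt0 nu_gt0; have a1 := h n; have a2 := h n.+1.
  have := ler_wpM2r (ltW p0) rn1; rewrite E.
  have -> : nu / (2 * (nu + n%:R)) * r n (nu ^+ 2) * b n (nu ^+ 2) =
    nu / (2 * (nu + n%:R)) * b n (nu ^+ 2) * r n (nu ^+ 2) by ring.
  have -> : beta n.+1 * nu ^+ 2 * r n (nu ^+ 2) * b n.+1 (nu ^+ 2) =
    nu / (2 * (nu + n%:R)) * (nu / (2 * (nu + n.+1%:R)) * b n.+1 (nu ^+ 2)) * r n (nu ^+ 2).
    rewrite /beta_coef -[n.+1%:R]natr1 addrA addrK; rewrite -[n.+1%:R]natr1 addrA in a2.
    by set a := nu + _ in a1 a2 *; field; rewrite !gt_eqF.
  rewrite ler_pM2r// ler_pM2l ?divr_gt0 ?mulr_gt0// => /le_trans; apply.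
  rewrite ler_wpM2r ?(ltW p1)// ler_pdivrMr ?mulr_gt0// mulrA mulVf// mul1r.
  by rewrite lerDl.
lra.
Qed.

Lemma is_derive_bessel_prime (s : R) : is_derive s (1 : R) G
  ((nu * b 1 s - 2 * (nu + 1) * b 0 s) / (8 * nu * (nu + 1))).
Proof.
have d0 := is_derive_bessel_fun nu_gt0 0 s.
have d1 := is_derive_bessel_fun nu_gt0 1 s.
have -> : G = (2^-1 \*: b 0) - (beta 1 \*: (id * b 1)).
  apply/funext => t; rewrite /bessel_prime !fctE.
  by change (b 0 t / 2 - beta 1 * t * b 1 t = 2^-1 * b 0 t - beta 1 * (t * b 1 t)); ring.
apply: is_derive_eq; rewrite /GRing.scale/= mulr1.
(* Expanding [b 0] by the recurrence matches the term in [b 2] that comes from differentiating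
   [b 1]. *)
rewrite (bessel_fun_rec nu_gt0 0) beta1E beta2E.
have -> : nu + 2 = (nu + 1) + 1 by lra.
by field; rewrite !gt_eqF ?addr_gt0.
Qed.

(** If [b 1 s] vanished, so would [b 0 s], and the recurrence would carry the zero to every [b n s],
    against [b n s -> 1]. *)
Lemma bessel_fun1_neq0 s : s != 0 -> G s = 0 -> b 1 s != 0.
Proof.
move=> s0 G0; apply/eqP => b1.
have H n : b n s = 0 /\ b n.+1 s = 0.
  elim: n => [|n [IH1 IH2]].
    by split => //; move: G0; rewrite /bessel_prime b1 mulr0 subr0; lra.
  split => //; move: (bessel_fun_rec nu_gt0 n s); rewrite IH1 IH2 sub0r => /esym/eqP.
  rewrite oppr_eq0 2!mulf_eq0 (negbTE s0) orbF => /orP[|/eqP//].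
  by rewrite gt_eqF ?beta_gt0.
have := bessel_fun_cvg1 nu_gt0 0 s; under eq_fun do rewrite (H _).1.
move=> h; have E : (1 : R) = 0 := cvg_unique (@Rhausdorff R) h (cvg_cst 0).
by have := oner_neq0 R; rewrite E eqxx.
Qed.

(** At a zero of [G] the derivative is a positive multiple of [b 1 s * (nu ^+ 2 - s)]. This reflects
    Bessel's equation: [z^2 J'' = (nu^2 - z^2) J] where [J' = 0]. *)
Lemma bessel_prime_simple s : 0 < s -> G s = 0 -> 'D_1 G s != 0.
Proof.
move=> s0 G0; have := is_derive_bessel_prime s => d; rewrite derive_val.
have b1 := bessel_fun1_neq0 (lt0r_neq0 s0) G0.
have sn : s != nu ^+ 2.
  by apply/eqP => sn; have := bessel_prime_nu2_neq0; rewrite -sn G0 eqxx.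
have -> : (nu * b 1 s - 2 * (nu + 1) * b 0 s) / (8 * nu * (nu + 1)) =
    b 1 s * (nu ^+ 2 - s) / (8 * nu ^+ 2 * (nu + 1)).
  move: G0; rewrite /bessel_prime beta1E => /subr0_eq G0.
  have -> : b 0 s = 2 * ((4 * nu * (nu + 1))^-1 * s * b 1 s) by rewrite -G0; lra.
  by field; rewrite !gt_eqF ?addr_gt0.
have h1 : nu ^+ 2 - s != 0 by rewrite subr_eq0 eq_sym.
have h2 : 8 * nu ^+ 2 * (nu + 1) != 0.
  by rewrite gt_eqF ?mulr_gt0 ?exprn_gt0 ?addr_gt0.
exact: mulf_neq0 (mulf_neq0 b1 h1) (invr_neq0 h2).
Qed.

(** * The zeros of [J'_nu] as square roots of the zeros of [G] *)

Lemma Gamma_rising m : Gamma (m%:R + nu + 1) = rising (nu + 1) m * Gamma (nu + 1).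
Proof.
elim: m => [|m IH]; first by rewrite add0r /rising big_ord0 mul1r.
have -> : m.+1%:R + nu + 1 = m%:R + nu + 1 + 1 by rewrite -natr1; ring.
rewrite (@Gamma_rec _ (m%:R + nu + 1)); last by rewrite -addrA ltr_wpDl// ltrDr.
by rewrite IH risingSr; ring.
Qed.

Lemma besselJE x : 0 < x ->
  besselJ nu x = (x / 2) `^ nu / Gamma (nu + 1) * b 0 (x ^+ 2).
Proof.
move=> x0; have g0 : 0 < Gamma (nu + 1) by apply: Gamma_gt0; rewrite ltrDr.
rewrite /besselJ; apply/cvg_lim => //.
have H1 : (x / 2) `^ nu / Gamma (nu + 1) * pseries (bessel_coef nu 0) (x ^+ 2) k
    @[k --> \oo] --> (x / 2) `^ nu / Gamma (nu + 1) * b 0 (x ^+ 2).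
  by apply: cvgMr; exact: bessel_fun_cvg.
suff -> : (fun n => \sum_(0 <= m < n) ((-1) ^+ m / (m`!%:R * Gamma (m%:R + nu + 1)) *
    (x / 2) `^ (2 * m%:R + nu))) =
  (fun k => (x / 2) `^ nu / Gamma (nu + 1) * pseries (bessel_coef nu 0) (x ^+ 2) k) by [].
apply/funext => k; rewrite /pseries seriesEnat/= mulr_sumr; apply: eq_bigr => m _.
have y0 : 0 < x / 2 by rewrite divr_gt0.
rewrite powRD; last by rewrite (gt_eqF y0) implybT.
rewrite -natrM powR_mulrn ?(ltW y0)//.
rewrite Gamma_rising /bessel_coef.
have f0 : (0 : R) < m`!%:R by rewrite ltr0n fact_gt0.
have r0 : 0 < rising (nu + 1) m by rewrite rising_gt0// ltr_wpDr.
have E : (-1) ^+ m * (x / 2) ^+ (2 * m) = (- 4^-1) ^+ m * (x ^+ 2) ^+ m.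
  by rewrite exprM -!exprMn; congr (_ ^+ _); field.
set A := _ ^+ m in E *; set B := _ ^+ (2 * m) in E *; set P := _ `^ _.
set C := _ ^+ m in E *; set D := _ ^+ m in E *.
set g := Gamma _ in g0 *; set f := _%:R in f0 *; set q := rising _ _ in r0 *.
have -> : A / (f * (q * g)) * (B * P) = A * B * (P / (f * q * g)).
  by field; rewrite !gt_eqF.
by rewrite E; field; rewrite !gt_eqF.
Qed.

Lemma derive1_besselJ x : 0 < x ->
  derive1 (besselJ nu) x =
  (x / 2) `^ nu / Gamma (nu + 1) * (2 * nu / x) * G (x ^+ 2).
Proof.
move=> x0; have g0 : 0 < Gamma (nu + 1) by apply: Gamma_gt0; rewrite ltrDr.
pose c := 2^-1 `^ nu / Gamma (nu + 1).
have cE t : 0 < t -> (t / 2) `^ nu / Gamma (nu + 1) = c * t `^ nu.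
  by move=> t0; rewrite powRM ?invr_ge0 ?(ltW t0)// /c; ring.
have d1 : is_derive x (1 : R) (fun t : R => t `^ nu) (nu * x `^ (nu - 1)).
  exact: is_derive1_powR.
have d2 : is_derive x (1 : R) (b 0 \o (fun t => t ^+ 2))
   ((2 * x) * (- (4 * (nu + 1))^-1 * b 1 (x ^+ 2))).
  have e1 := is_derive_bessel_fun nu_gt0 0 (x ^+ 2).
  have e2 : is_derive x (1 : R) (fun t : R => t ^+ 2) (2 * x).
    have -> : (fun t : R => t ^+ 2) = id * id by apply/funext => t; rewrite expr2.
    by apply: is_derive_eq; rewrite /GRing.scale/= mulr1 mulr2n mulrDl mul1r.
  by have := @is_derive1_comp R (b 0) (fun t => t ^+ 2) x _ _ e1 e2; rewrite mulrC.
have d3 : is_derive x (1 : R) (c \*: ((fun t : R => t `^ nu) * (b 0 \o (fun t => t ^+ 2))))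
  ((x / 2) `^ nu / Gamma (nu + 1) * (2 * nu / x) * G (x ^+ 2)).
  apply: is_derive_eq; rewrite cE// /bessel_prime beta1E.
  rewrite powRB; last by rewrite (gt_eqF x0) implybT.
  rewrite powRr1 ?ltW// /GRing.scale/=.
  by field; rewrite !gt_eqF ?addr_gt0.
rewrite derive1E; apply: derive_val.
(* The closed form of [besselJ] holds at positive points only, so the derivative is transferred by
   equality near [x]. *)
apply: near_eq_is_derive d3; near=> t.
have t0 : 0 < t by near: t; exact: lt_nbhsr.
rewrite besselJE// cE//.
by change (c * (t `^ nu * b 0 (t ^+ 2)) = c * t `^ nu * b 0 (t ^+ 2)); rewrite mulrA.
Unshelve. all: by end_near. Qed.

Lemma derive1_besselJ_eq0 x : 0 < x ->
  derive1 (besselJ nu) x = 0 <-> G (x ^+ 2) = 0.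
Proof.
move=> x0; have g0 : 0 < Gamma (nu + 1) by apply: Gamma_gt0; rewrite ltrDr.
rewrite derive1_besselJ//; split=> [/eqP|->]; last by rewrite mulr0.
rewrite mulf_eq0 => /orP[|/eqP//].
by rewrite gt_eqF// !mulr_gt0 ?invr_gt0 ?powR_gt0// divr_gt0.
Qed.

End Limit.

(** * Limits of the roots *)

Section StrictlyIncreasing.
Variable R : realType.

(** By strong induction: if the sequences agree below [n], each value at [n] is the least element of
    the common range not yet listed. *)
Lemma strict_incr_eq (f g : nat -> R) :
  (forall n, f n < f n.+1) -> (forall n, g n < g n.+1) ->
  (forall n, exists m, f n = g m) -> (forall n, exists m, g n = f m) -> f =1 g.
Proof.
move=> fi gi fg gf.
have homo (h : nat -> R) : (forall n, h n < h n.+1) -> forall m n, (m < n)%N -> h m < h n.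
  by move=> hi m n mn; exact: (homo_ltn lt_trans hi).
have le (h k : nat -> R) n : (forall n, k n < k n.+1) -> (forall m n, (m < n)%N -> h m < h n) ->
    (forall m, (m < n)%N -> h m = k m) -> (exists m, h n = k m) -> k n <= h n.
  move=> ki hlt hk [m hm]; rewrite hm; case: (leqP n m) => [|mn].
    rewrite leq_eqVlt => /orP[/eqP->//|nm]; exact/ltW/homo.
  by have := hlt _ _ mn; rewrite hm (hk _ mn) ltxx.
elim/ltn_ind => n IH; apply/eqP; rewrite eq_le; apply/andP; split.
  apply: (le g f) => // [|m mn]; last by rewrite IH.
  exact: homo.
by apply: (le f g) => //; exact: homo.
Qed.

End StrictlyIncreasing.

Section RootLimits.
Local Open Scope classical_set_scope.
Variables (R : realType) (nu : R).
Hypothesis nu_gt0 : 0 < nu.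
Variable y : nat -> nat -> R.
Hypothesis yroots : forall n, lommel_roots nu n (y n).
Hypothesis ymono : forall n i, y n i <= y n.+1 i.
Notation G := (bessel_prime nu).

Lemma root_ge0 n i : 0 <= y n i.
Proof.
case: (ltnP i n.+1./2) => h; first exact/ltW/(lommel_roots_gt0 (yroots n)).
by rewrite (lommel_roots_eq0 (yroots n)).
Qed.

Lemma root_le n i : y n i.+1 <= y n i.
Proof.
case: (ltnP i.+1 n.+1./2) => h; first exact/ltW/(lommel_roots_decr (yroots n)).
by rewrite (lommel_roots_eq0 (yroots n) h) root_ge0.
Qed.

(** The zeros that pad [y n] contribute factors 1, so the number of factors is free. *)
Lemma lommel_prod n K t : (n.+1./2 <= K)%N ->
  (lommel nu n.+1).[t] = 2^-1 * \prod_(i < K) (1 - y n i * t).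
Proof.
move=> nK; rewrite (lommel_roots_prod (yroots n)) hornerZ horner_prod_linear.
congr (_ * _); rewrite -!(big_mkord xpredT (fun i => 1 - y n i * t)).
rewrite [RHS](big_cat_nat _ nK)//= [X in _ * X]big_nat [X in _ * X]big1 ?mulr1// => i /andP[hi _].
by rewrite (lommel_roots_eq0 (yroots n))// mul0r subr0.
Qed.

(** The Weierstrass product inequality; its counterpart for the factors [1 - a i] follows. *)
Lemma ler1_sum_prod (I : Type) (r : seq I) (a : I -> R) : (forall i, 0 <= a i) ->
  1 + \sum_(i <- r) a i <= \prod_(i <- r) (1 + a i).
Proof.
move=> a0; elim: r => [|i r IH]; first by rewrite !big_nil addr0.
rewrite !big_cons; apply: le_trans (ler_wpM2l _ IH); last by rewrite addr_ge0.
rewrite mulrDl mul1r mulrDr mulr1.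
have : 0 <= a i * \sum_(j <- r) a j by rewrite mulr_ge0// sumr_ge0.
lra.
Qed.

Lemma ler1_sub_sum_prod (I : Type) (r : seq I) (a : I -> R) : (forall i, 0 <= a i) ->
  \sum_(i <- r) a i <= 1 ->
  1 - \sum_(i <- r) a i <= \prod_(i <- r) (1 - a i).
Proof.
move=> a0; elim: r => [|i r IH]; first by rewrite !big_nil subr0.
rewrite !big_cons => s1.
have s0 : 0 <= \sum_(j <- r) a j by rewrite sumr_ge0.
have ai := a0 i.
have {}IH : 1 - \sum_(j <- r) a j <= \prod_(j <- r) (1 - a j) by apply: IH; lra.
apply: le_trans (ler_wpM2l _ IH); last by lra.
rewrite mulrBl mul1r mulrBr mulr1.
have : 0 <= a i * \sum_(j <- r) a j by rewrite mulr_ge0.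
lra.
Qed.

(** At the point -1 the factors are [1 + y n i], so their product dominates the sum, while
    [lommel_bounded] bounds it uniformly in [n]. *)
Lemma root_sum_bounded : exists2 B : R, 0 <= B &
  forall n K, \sum_(i < K) y n i <= B.
Proof.
have [C C0 hC] := lommel_bounded nu_gt0 (-1).
exists (2 * C); first by rewrite mulr_ge0// ltW.
move=> n K.
have H : \sum_(i < K + n.+1) y n i <= 2 * C.
  have h1 : 1 + \sum_(i < K + n.+1) y n i <= \prod_(i < K + n.+1) (1 + y n i).
    by apply: ler1_sum_prod => i; exact: root_ge0.
  have E : (lommel nu n.+1).[-1] = 2^-1 * \prod_(i < K + n.+1) (1 + y n i).
    rewrite (@lommel_prod _ (K + n.+1)); last by lia.
    by congr (_ * _); apply: eq_bigr => i _; rewrite mulrN1 opprK.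
  have := hC n.+1; rewrite E => /(le_trans (ler_norm _)); lra.
apply: le_trans H; rewrite -!(big_mkord xpredT (y n)) (@big_cat_nat _ _ _ K _ (K + n.+1))//= ?leq_addr//.
by rewrite lerDl sumr_ge0// => i _; exact: root_ge0.
Qed.

Lemma root_is_cvg i : cvgn (y ^~ i).
Proof.
have [B B0 hB] := root_sum_bounded.
apply: nondecreasing_is_cvgn; first by apply/nondecreasing_seqP => n; exact: ymono.
exists B => _ [n _ <-]; apply: le_trans (hB n i.+1).
by rewrite big_ord_recr/= lerDr sumr_ge0// => k _; exact: root_ge0.
Qed.

Definition root_lim i : R := limn (y ^~ i).
Notation ys := root_lim.

Lemma root_cvg i : y ^~ i @ \oo --> ys i.
Proof. exact: root_is_cvg. Qed.

Lemma root_le_lim n i : y n i <= ys i.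
Proof.
have nd : nondecreasing_seq (y ^~ i) by apply/nondecreasing_seqP => k; exact: ymono.
exact: (nondecreasing_cvgn_le nd (@root_is_cvg i) n).
Qed.

Lemma root_lim_gt0 i : 0 < ys i.
Proof.
(* At index [2 i + 2] there are [i + 1] roots, so the entry [i] is not padding. *)
apply: lt_le_trans (root_le_lim i.+1.*2 i).
by apply: (lommel_roots_gt0 (yroots _)); lia.
Qed.

Lemma root_lim_le i : ys i.+1 <= ys i.
Proof.
by apply: (ler_cvg_to (@root_cvg i.+1) (@root_cvg i)); apply: nearW => n; exact: root_le.
Qed.

Lemma cvg_sum_ord (T : Type) (F : set_system T) (FF : Filter F)
    (f : nat -> T -> R) (l : nat -> R) K :
  (forall i, (i < K)%N -> f i @ F --> l i) ->
  (fun n => \sum_(i < K) f i n) @ F --> \sum_(i < K) l i.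
Proof.
elim: K => [|K IH] h.
  by under eq_fun do rewrite big_ord0; rewrite big_ord0; exact: cvg_cst.
under eq_fun do rewrite big_ord_recr/=; rewrite big_ord_recr/=.
by apply: cvgD; [apply: IH => i iK; apply: h; exact: ltnW|exact: h].
Qed.

Lemma cvg_prod_ord (T : Type) (F : set_system T) (FF : Filter F)
    (f : nat -> T -> R) (l : nat -> R) K :
  (forall i, f i @ F --> l i) ->
  (fun n => \prod_(i < K) f i n) @ F --> \prod_(i < K) l i.
Proof.
move=> h; elim: K => [|K IH].
  by under eq_fun do rewrite big_ord0; rewrite big_ord0; exact: cvg_cst.
by under eq_fun do rewrite big_ord_recr/=; rewrite big_ord_recr/=; exact: cvgM.
Qed.

Lemma root_lim_sum_bounded : exists2 B : R, 0 <= B &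
  forall K, \sum_(i < K) ys i <= B.
Proof.
have [B B0 hB] := root_sum_bounded; exists B => // K.
have h : \sum_(i < K) y n i @[n --> \oo] --> \sum_(i < K) ys i.
  by apply: (@cvg_sum_ord _ _ _ (fun i n => y n i)) => i _; exact: root_cvg.
by apply: (cvgr_to_le h); apply: nearW => n; exact: hB.
Qed.

Lemma lommel_factor_cvg t i : 1 - y n i * t @[n --> \oo] --> 1 - ys i * t.
Proof.
by apply: cvgB; [exact: cvg_cst|apply: cvgMl; exact: root_cvg].
Qed.

Lemma norm_lommel_cvg t : `|(lommel nu n.+1).[t]| @[n --> \oo] --> `|G t|.
Proof.
apply: cvg_norm; rewrite (@cvg_shiftS _ (fun n => (lommel nu n).[t])).
exact: lommel_cvg.
Qed.

(** Each factor is at most [expR (y n i * t)]. The predicate allows one or two factors to be set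
    aside in the bounds below. *)
Lemma prod_linear_le K (P : pred 'I_K) n t B : 0 <= t -> (forall K, \sum_(i < K) y n i <= B) ->
  \prod_(i < K | P i) `|1 - y n i * t| <= expR (B * t).
Proof.
move=> t0 hB; apply: (@le_trans _ _ (\prod_(i < K) expR (y n i * t))).
  rewrite [leRHS](bigID P)/= -[leLHS]mulr1 ler_pM//.
  - by apply: prodr_ge0.
  - apply: ler_prod => i _; rewrite normr_ge0/=; apply: le_trans (expR_ge1Dx _).
    apply: le_trans (ler_normB _ _) _.
    by rewrite normr1 lerD2l ger0_norm// mulr_ge0// root_ge0.
  - apply: (@big_ind _ (fun x : R => 1 <= x)) => // [u v u1 v1|i _].
      by rewrite -[leLHS]mulr1 ler_pM.
    by rewrite -[leLHS]expR0 ler_expR mulr_ge0 ?root_ge0.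
by rewrite -expR_sum ler_expR -mulr_suml ler_wpM2r.
Qed.

Lemma bessel_prime_bound i : exists2 B : R, 0 <= B &
  forall t, 0 <= t -> `|G t| <= `|1 - ys i * t| * expR (B * t).
Proof.
have [B B0 hB] := root_sum_bounded.
exists B => // t t0.
have h1 := @norm_lommel_cvg t.
have h2 : `|1 - y n i * t| * expR (B * t) @[n --> \oo] --> `|1 - ys i * t| * expR (B * t).
  by apply: cvgMl; apply: cvg_norm; exact: lommel_factor_cvg.
apply: (ler_cvg_to h1 h2); apply: nearW => n /=.
have iK : (i < n + i.+1)%N by lia.
rewrite (@lommel_prod n (n + i.+1)%N); last by lia.
rewrite normrM (bigD1 (Ordinal iK))//= normrM normr_prod mulrCA ler_wpM2l//.
rewrite -[leRHS]mul1r ler_pM ?prodr_ge0//; last exact: prod_linear_le.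
by rewrite ger0_norm ?invr_ge0// invf_le1// ler1n.
Qed.

(** With two factors kept, equal limits [ys i = ys k] would make [G] quadratically small at their
    common reciprocal; [root_lim_lt] plays this against the simplicity of the zeros. *)
Lemma bessel_prime_bound2 i k : i != k -> exists2 B : R, 0 <= B &
  forall t, 0 <= t -> `|G t| <= `|1 - ys i * t| * `|1 - ys k * t| * expR (B * t).
Proof.
move=> ik; have [B B0 hB] := root_sum_bounded.
exists B => // t t0.
have h1 := @norm_lommel_cvg t.
have h2 : `|1 - y n i * t| * `|1 - y n k * t| * expR (B * t) @[n --> \oo]
    --> `|1 - ys i * t| * `|1 - ys k * t| * expR (B * t).
  by apply: cvgMl; apply: cvgM; apply: cvg_norm; exact: lommel_factor_cvg.
apply: (ler_cvg_to h1 h2); apply: nearW => n /=.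
have iK : (i < n + (i + k).+1)%N by lia.
have kK : (k < n + (i + k).+1)%N by lia.
rewrite (@lommel_prod n (n + (i + k).+1)%N); last by lia.
rewrite normrM (bigD1 (Ordinal iK))//= (bigD1 (Ordinal kK))/=; last first.
  by rewrite -val_eqE/= eq_sym.
rewrite !normrM normr_prod mulrCA -mulrA ler_wpM2l// mulrCA ler_wpM2l//.
rewrite -[leRHS]mul1r ler_pM ?prodr_ge0//; last exact: prod_linear_le.
by rewrite ger0_norm ?invr_ge0// invf_le1// ler1n.
Qed.

Lemma root_lim_zero i : G (ys i)^-1 = 0.
Proof.
have [C C0 hC] := bessel_prime_bound i.
have t0 : 0 <= (ys i)^-1 by rewrite invr_ge0 ltW// root_lim_gt0.
have := hC _ t0; rewrite mulfV ?gt_eqF ?root_lim_gt0// subrr normr0 mul0r.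
by rewrite normr_le0 => /eqP.
Qed.

Lemma root_lim_lt i : ys i.+1 < ys i.
Proof.
rewrite lt_neqAle root_lim_le andbT; apply/eqP => E.
pose s := (ys i)^-1.
have s0 : 0 < s by rewrite invr_gt0 root_lim_gt0.
have Gs : G s = 0 := root_lim_zero i.
have [//|B B0 hB] := @bessel_prime_bound2 i i.+1; first by rewrite neq_ltn ltnSn.
have := bessel_prime_simple nu_gt0 s0 Gs; apply/negP; rewrite negbK; apply/eqP.
have ys1 : ys i * s = 1 by rewrite mulfV// gt_eqF// root_lim_gt0.
rewrite /derive; apply/cvg_lim => //; apply/norm_cvg0P.
(* For [|h| < 1] the exponential factor at [s + h] is at most its value at [s + 1], so the
   difference quotient is at most [|h| * C]. *)
pose C := ys i * ys i * expR (B * (s + 1)).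
have h1 : `|h| * C @[h --> (0 : R)^'] --> (0 : R).
  rewrite -[X in _ --> X](mul0r C); apply: cvgMl.
  rewrite -[X in _ --> X](@normr0 _ R); apply: cvg_norm; exact: nbhs_dnbhs.
apply: (squeeze_cvgr _ (cvg_cst 0) h1); near=> h.
have h0 : h != 0 by near: h; exact: nbhs_dnbhs_neq.
have hs : `|h| < s by near: h; exact: dnbhs0_lt.
have h1' : `|h| < 1 by near: h; exact: dnbhs0_lt.
rewrite normr_ge0/= Gs subr0 normrZ normfV ler_pdivrMl ?normr_gt0//.
have -> : (h *: (1 : R) + s) = s + h by rewrite addrC /GRing.scale/= mulr1.
have sh : 0 <= s + h by move: hs; rewrite ltr_norml => /andP[]; lra.
apply: le_trans (hB _ sh) _; rewrite E !mulrDr ys1 opprD addNKr normrN normrM.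
rewrite (gtr0_norm (root_lim_gt0 i)).
have -> : `|h| * (`|h| * C) = ys i * `|h| * (ys i * `|h|) * expR (B * (s + 1)).
  by rewrite /C; ring.
rewrite -mulrDr ler_wpM2l ?mulr_ge0 ?(ltW (root_lim_gt0 i))// ler_expR ler_wpM2l//.
by move: h1'; rewrite ltr_norml => /andP[]; lra.
Unshelve. all: by end_near. Qed.

(** If [t] is no such number, finitely many leading factors have a nonzero limit, and the product of
    the others stays away from 0 uniformly in [n]; hence [G t] is not 0. *)
Lemma bessel_prime_zero t : 0 < t -> G t = 0 -> exists i, t = (ys i)^-1.
Proof.
move=> t0 Gt; apply: contrapT => /forallNP no.
have ne i : 1 - ys i * t != 0.
  apply/eqP => /subr0_eq h; apply: (no i).
  by rewrite -[LHS](mulKf (lt0r_neq0 (root_lim_gt0 i))) -h mulr1.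
have [B B0 hB] := root_lim_sum_bounded.
pose S K := \sum_(i < K) ys i.
have Snd : nondecreasing_seq S.
  by apply/nondecreasing_seqP => K; rewrite /S big_ord_recr/= lerDl ltW// root_lim_gt0.
have Scvg : cvgn S.
  by apply: nondecreasing_is_cvgn => //; exists B => _ [K _ <-]; exact: hB.
have e0 : 0 < (2 * t)^-1 by rewrite invr_gt0 mulr_gt0.
have [I hI] : exists I, forall K, S K <= S I + (2 * t)^-1.
  have : \forall K \near \oo, limn S - (2 * t)^-1 < S K.
    by apply: (cvgr_gt _ Scvg); rewrite ltrBlDr ltrDl.
  move=> [I _ hI]; exists I => K.
  have := hI I (leqnn I); have := nondecreasing_cvgn_le Snd Scvg K; rewrite /=; lra.
(* One factor 1/2 is the constant term of [lommel]; the other bounds the tail product, as the choice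
   of [I] makes the sum of the [y n i * t] over the tail at most 1/2. *)
have key n : 4^-1 * `|\prod_(i < I) (1 - y n i * t)| <= `|(lommel nu n.+1).[t]|.
  rewrite (@lommel_prod n (I + n.+1)%N); last by lia.
  rewrite normrM -!(big_mkord xpredT (fun i => 1 - y n i * t)).
  rewrite [in leRHS](@big_cat_nat _ _ _ I)//= ?leq_addr// normrM.
  have h : 2^-1 <= `|\prod_(I <= i < I + n.+1) (1 - y n i * t)|.
    apply: le_trans (ler_norm _).
    have hs : \sum_(I <= i < I + n.+1) y n i * t <= 2^-1.
      rewrite -mulr_suml; apply: (@le_trans _ _ ((2 * t)^-1 * t)); last first.
        by rewrite invfM mulfVK ?gt_eqF.
      rewrite ler_wpM2r ?(ltW t0)//.
      apply: (@le_trans _ _ (\sum_(I <= i < I + n.+1) ys i)).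
        by apply: ler_sum => i _; exact: root_le_lim.
      have := hI (I + n.+1)%N; rewrite /S -!(big_mkord xpredT ys).
      by rewrite (@big_cat_nat _ _ _ I 0 (I + n.+1))//= ?leq_addr// lerD2l.
    apply: le_trans (ler1_sub_sum_prod _ _); first by lra.
    - by move=> i; rewrite mulr_ge0 ?root_ge0// ltW.
    - by lra.
  have := ler_wpM2l (normr_ge0 (\prod_(0 <= i < I) (1 - y n i * t))) h.
  rewrite (gtr0_norm (_ : 0 < 2^-1)) ?invr_gt0//.
  set a := `|_|; set b := `|_|; lra.
have h1 := @norm_lommel_cvg t; rewrite Gt normr0 in h1.
have h2 : 4^-1 * `|\prod_(i < I) (1 - y n i * t)| @[n --> \oo] -->
    4^-1 * `|\prod_(i < I) (1 - ys i * t)|.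
  apply: cvgMr; apply: cvg_norm.
  exact: (@cvg_prod_ord _ _ _ (fun i n => 1 - y n i * t) _ _ (@lommel_factor_cvg t)).
have : 4^-1 * `|\prod_(i < I) (1 - ys i * t)| <= 0.
  by apply: (ler_cvg_to h2 h1); apply: nearW.
apply/negP; rewrite -ltNge mulr_gt0 ?invr_gt0// normr_gt0.
by apply/prodf_neq0 => i _; exact: ne.
Qed.

(** Monotone convergence by squeezing: the partial sums of the limits lie above those of [y n], and
    below [P] by passing to the limit in finitely many terms. *)
Lemma root_lim_power_sum m (P : R) :
  \sum_(i < n) y n i ^+ m @[n --> \oo] --> P ->
  \sum_(i < K) ys i ^+ m @[K --> \oo] --> P.
Proof.
move=> hP.
have up K : \sum_(i < K) ys i ^+ m <= P.
  have h : \sum_(i < K) y n i ^+ m @[n --> \oo] --> \sum_(i < K) ys i ^+ m.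
    apply: (@cvg_sum_ord _ _ _ (fun i n => y n i ^+ m) (fun i => ys i ^+ m)) => i _.
    exact: (continuous_cvg _ (@exprn_continuous _ m _) (@root_cvg i)).
  apply: (ler_cvg_to h hP); near=> n.
  have Kn : (K <= n)%N by near: n; exact: nbhs_infty_ge.
  rewrite -!(big_mkord xpredT (fun i => y n i ^+ m)) (big_cat_nat _ Kn)//= lerDl.
  by rewrite sumr_ge0// => i _; rewrite exprn_ge0 ?root_ge0.
apply: (squeeze_cvgr _ hP (cvg_cst P)); apply: nearW => n; rewrite up andbT.
by apply: ler_sum => i _; rewrite lerXn2r ?nnegrE ?root_ge0 ?root_le_lim ?ltW ?root_lim_gt0.
Unshelve. all: by end_near. Qed.

(** The squares of the [j] and the reciprocals of the [ys] both list the positive zeros of [G]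
    increasingly. *)
Lemma zeros_root_lim j : besselJ'_zeros nu j -> forall i : nat, (j i.+1%:Z ^+ 2)^-1 = ys i.
Proof.
case=> jpos jincr jP _ i.
suff -> : j i.+1%:Z ^+ 2 = (ys i)^-1 by rewrite invrK.
apply: (@strict_incr_eq _ (fun i : nat => j i.+1%:Z ^+ 2) (fun i => (ys i)^-1)) => n.
- by rewrite ltrXn2r ?nnegrE ?(ltW (jpos _ _)) ?jincr.
- by rewrite ltf_pV2 ?posrE ?root_lim_gt0// root_lim_lt.
- apply: bessel_prime_zero; first by rewrite exprn_gt0 ?jpos.
  by apply/derive1_besselJ_eq0; rewrite ?jpos//; apply/jP; [exact: jpos|exists n.+1].
- pose t := Num.sqrt (ys n)^-1.
  have t0 : 0 < t by rewrite sqrtr_gt0 invr_gt0 root_lim_gt0.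
  have tE : t ^+ 2 = (ys n)^-1 by rewrite sqr_sqrtr// invr_ge0 ltW// root_lim_gt0.
  have /(jP _ t0)[[|k]//= _ tk] : derive1 (besselJ nu) t = 0.
    by apply/derive1_besselJ_eq0 => //; rewrite tE root_lim_zero.
  by exists k; rewrite -tE tk.
Qed.

End RootLimits.

(** * Convergence of coefficients and power sums *)

Section CoefLimits.
Local Open Scope classical_set_scope.
Variables (R : realType) (nu : R).
Hypothesis nu_gt0 : 0 < nu.
Notation beta := (beta_coef nu).

Definition bessel_prime_coef (m : nat) : R :=
  2^-1 * bessel_coef nu 0 m - (if m is k.+1 then beta 1 * bessel_coef nu 1 k else 0).
Notation g := bessel_prime_coef.

(** Power series are represented by truncations, and their identities by divisibility by ['X^M]. *)
Definition bessel_poly M n : {poly R} := \poly_(m < M) bessel_coef nu n m.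
Definition bessel_prime_poly M : {poly R} := \poly_(m < M) g m.

Lemma dvdXnP (M : nat) (p : {poly R}) :
  reflect (forall i, (i < M)%N -> p`_i = 0) ('X^M %| p).
Proof.
apply: (iffP idP) => [/dvdpP[u ->] i iM|h]; first by rewrite coefMXn iM.
rewrite -(poly_take_drop M p) (_ : take_poly M p = 0) ?add0r ?dvdp_mull//.
by apply/polyP => i; rewrite coef_take_poly coef0; case: ifP => // /h.
Qed.

Lemma coefM_poly (p : {poly R}) (f : nat -> R) M m : (m < M)%N ->
  (p * \poly_(i < M) f i)`_m = \sum_(i < m.+1) p`_i * f (m - i)%N.
Proof.
move=> mM; rewrite coefM; apply: eq_bigr => i _.
by rewrite coef_poly (leq_ltn_trans (leq_subr _ _) mM).
Qed.

Lemma bessel_poly_rec M n : 'X^M %| bessel_poly M n -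
  (bessel_poly M n.+1 - beta n.+2 *: ('X * bessel_poly M n.+2)).
Proof.
apply/dvdXnP => -[|i] iM; rewrite !(coefB, coefZ, coefXM, coef_poly) iM/=.
  by rewrite !bessel_coef0 mulr0 subr0 subrr.
by rewrite (ltnW iM) (bessel_coef_rec nu_gt0) subrr.
Qed.

Lemma bessel_prime_polyE M : 'X^M %| bessel_prime_poly M -
  (2^-1 *: bessel_poly M 0 - beta 1 *: ('X * bessel_poly M 1)).
Proof.
apply/dvdXnP => -[|i] iM; rewrite !(coefB, coefZ, coefXM, coef_poly) iM/=.
  by rewrite mulr0 subrr.
by rewrite (ltnW iM) subrr.
Qed.

Lemma lommel_casoratian_poly M n : 'X^M %| lommel nu n.+1 * bessel_poly M n -
  beta n.+1 *: ('X * (lommel nu n * bessel_poly M n.+1)) - bessel_prime_poly M.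
Proof.
elim: n => [|n IH].
  rewrite -dvdpNr opprB opprD opprK addrA.
  have := bessel_prime_polyE M; rewrite opprB addrA /= mul1r mul_polyC.
  by rewrite -!addrA [- _ + _]addrC.
rewrite lommelSS; set L1 := lommel nu n.+1 in IH *; set L0 := lommel nu n in IH *.
set B0 := bessel_poly M n in IH; set B1 := bessel_poly M n.+1 in IH *.
set B2 := bessel_poly M n.+2.
have -> : (L1 - beta n.+1 *: ('X * L0)) * B1 - beta n.+2 *: ('X * (L1 * B2)) - bessel_prime_poly M
  = (L1 * B0 - beta n.+1 *: ('X * (L0 * B1)) - bessel_prime_poly M) -
    L1 * (B0 - (B1 - beta n.+2 *: ('X * B2))).
  by rewrite -!mul_polyC; ring.
by rewrite dvdp_sub ?dvdp_mull ?bessel_poly_rec.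
Qed.

Lemma bessel_coef_cvg0 k m : bessel_coef nu (n + k) m.+1 @[n --> \oo] --> (0 : R).
Proof.
have h : (1 / (4 * (nu + (n + k.+1)%:R))) ^+ m.+1 / m.+1`!%:R @[n --> \oo] --> (0 : R).
  rewrite -[X in _ --> X](mul0r (m.+1`!%:R)^-1); apply: cvgMl.
  rewrite -[X in _ --> X](expr0n R m.+1).
  exact: (continuous_cvg _ (@exprn_continuous _ m.+1 _) (@inv_nu_cvg0 _ nu nu_gt0 1 k)).
apply/norm_cvg0P; apply: (squeeze_cvgr _ (cvg_cst 0) h); apply: nearW => n.
rewrite normr_ge0/=; have := bessel_coef_norm nu_gt0 (n + k) m.+1 1.
by rewrite expr1n mulr1 normr1 /exp_coeff/= addnS.
Qed.

Lemma bessel_coef_is_cvg k m : exists l : R, bessel_coef nu (n + k) m @[n --> \oo] --> l.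
Proof.
case: m => [|m]; last by exists 0; exact: bessel_coef_cvg0.
by exists 1; under eq_fun do rewrite bessel_coef0; exact: cvg_cst.
Qed.

(** The formal Casoratian identity expresses this coefficient through lower ones. Those are
    multiplied by [beta] or by coefficients of [b_n] of positive degree, which tend to 0. *)
Lemma lommel_coef_cvg m : (lommel nu n)`_m @[n --> \oo] --> g m.
Proof.
elim/ltn_ind: m => m IH.
have E n : (lommel nu n.+1)`_m = g m
    - \sum_(i < m) (lommel nu n.+1)`_i * bessel_coef nu (n + 0) (m - i)
    + beta n.+1 * (if m is k.+1 then
        \sum_(i < k.+1) (lommel nu n)`_i * bessel_coef nu (n + 1) (k - i) else 0).
  have /dvdXnP/(_ m (ltnSn m)) := lommel_casoratian_poly m.+1 n.
  rewrite !coefB coefZ coefXM coef_poly ltnSn coefM_poly// big_ord_recr/= subnn.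
  rewrite bessel_coef0 mulr1 addn0 addn1.
  case: m {IH} => [|k] /=; last rewrite coefM_poly//.
    by rewrite !mulr0 !subr0 addr0 !big_ord0 add0r subr0 => /subr0_eq.
  set S1 := \sum_(i < k.+1) _; set S2 := \sum_(i < k.+1) _.
  by set c := beta n.+1; move=> h; lra.
have h1 : \sum_(i < m) (lommel nu n.+1)`_i * bessel_coef nu (n + 0) (m - i) @[n --> \oo]
    --> \sum_(i < m) (g i * 0).
  apply: (@cvg_sum_ord _ _ _ _
    (fun i n => (lommel nu n.+1)`_i * bessel_coef nu (n + 0) (m - i)) (fun i => g i * 0)) => i im.
  apply: cvgM; first by rewrite (@cvg_shiftS _ (fun n => (lommel nu n)`_i)); exact: IH.
  have [k ->] : exists k, (m - i)%N = k.+1 by exists (m - i).-1; lia.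
  exact: bessel_coef_cvg0.
have [l hl] : exists l : R, (if m is k.+1 then
    \sum_(i < k.+1) (lommel nu n)`_i * bessel_coef nu (n + 1) (k - i) else 0) @[n --> \oo] --> l.
  case: m IH {E h1} => [|k] IH; first by exists 0; exact: cvg_cst.
  have /choice[l hl] i := bessel_coef_is_cvg 1 (k - i).
  exists (\sum_(i < k.+1) (g i * l i)).
  apply: (@cvg_sum_ord _ _ _ _
    (fun i n => (lommel nu n)`_i * bessel_coef nu (n + 1) (k - i)) (fun i => g i * l i)) => i ik.
  by apply: cvgM; [exact: IH|exact: hl].
rewrite -(@cvg_shiftS _ (fun n => (lommel nu n)`_m)).
have h2 := cvgD (cvgB (cvg_cst (g m)) h1) (cvgM (@beta_cvg0 _ nu nu_gt0) hl).
rewrite big1 ?subr0 ?mul0r ?addr0 in h2; last by move=> i _; rewrite mulr0.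
by rewrite (funext E); exact: h2.
Qed.

(** Newton's identities, from the logarithmic derivative [- y / (1 - y X) = - sum_m y^(m+1) X^m] of
    each factor. *)
Lemma newton_prod (y : nat -> R) K M :
  'X^M %| (\prod_(i < K) (1 - y i *: 'X))^`() +
     \prod_(i < K) (1 - y i *: 'X) * \poly_(m < M) \sum_(i < K) y i ^+ m.+1.
Proof.
elim: K => [|K IH].
  rewrite big_ord0 derivC add0r mul1r; apply/dvdXnP => i iM.
  by rewrite coef_poly iM big_ord0.
rewrite big_ord_recr/=; set P := \prod_(i < K) _ in IH *.
have -> : \poly_(m < M) (\sum_(i < K.+1) y i ^+ m.+1) =
    \poly_(m < M) (\sum_(i < K) y i ^+ m.+1) + \poly_(m < M) y K ^+ m.+1.
  by apply/polyP => m; rewrite coefD !coef_poly; case: ifP; rewrite ?addr0// big_ord_recr.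
set S := \poly_(m < M) (\sum_(i < K) _) in IH *; set Q := \poly_(m < M) _.
rewrite derivM derivB derivC derivZ derivX.
have -> : P^`() * (1 - y K *: 'X) + P * (0 - y K *: 1) + P * (1 - y K *: 'X) * (S + Q) =
   (P^`() + P * S) * (1 - y K *: 'X) + P * ((1 - y K *: 'X) * Q - y K *: 1) by ring.
apply: dvdp_add; first exact: dvdp_mulr.
apply: dvdp_mull; apply/dvdXnP => i iM.
rewrite mulrBl mul1r -scalerAl !coefB !coefZ coefXM coef1 !coef_poly iM.
case: i iM => [|i] iM /=; first by rewrite mulr0 subr0 mulr1 expr1 subrr.
by rewrite (ltnW iM) mulr0 subr0 -exprS subrr.
Qed.

Lemma newton_lommel (y : nat -> nat -> R) : (forall n, lommel_roots nu n (y n)) ->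
  forall n k, k.+1%:R * (lommel nu n.+1)`_k.+1 +
    \sum_(i < k.+1) (lommel nu n.+1)`_i * \sum_(l < n) y n l ^+ (k - i).+1 = 0.
Proof.
move=> yr n k; have nK : (n.+1./2 <= n)%N by lia.
have -> : lommel nu n.+1 = 2^-1 *: \prod_(i < n) (1 - y n i *: 'X).
  rewrite (lommel_roots_prod (yr n)); congr (_ *: _).
  rewrite -!(big_mkord xpredT (fun i => 1 - y n i *: 'X)) [RHS](big_cat_nat _ nK)//=.
  rewrite [X in _ * X]big_nat [X in _ * X]big1 ?mulr1// => i /andP[hi _].
  by rewrite (lommel_roots_eq0 (yr n))// scale0r subr0.
have /dvdXnP/(_ k (ltnSn k)) := newton_prod (y n) n k.+1.
set P := \prod_(i < n) _; rewrite coefD coef_deriv coefM_poly// => h.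
rewrite coefZ; under eq_bigr do rewrite coefZ -mulrA.
rewrite -mulr_sumr mulrCA -mulrDr mulr_natl.
by rewrite h mulr0.
Qed.

Lemma power_sum_cvg (y : nat -> nat -> R) : (forall n, lommel_roots nu n (y n)) ->
  exists2 P : nat -> R,
    forall m, \sum_(l < n) y n l ^+ m.+1 @[n --> \oo] --> P m &
    forall k, k.+1%:R * g k.+1 + \sum_(i < k.+1) g i * P (k - i)%N = 0.
Proof.
move=> yr; have newton := newton_lommel yr.
have cS i : (lommel nu n.+1)`_i @[n --> \oo] --> g i.
  by rewrite (@cvg_shiftS _ (fun n => (lommel nu n)`_i)); exact: lommel_coef_cvg.
have /choice[P hP] : forall m, exists l : R, \sum_(l < n) y n l ^+ m.+1 @[n --> \oo] --> l.
  elim/ltn_ind => m IH.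
  have /choice[P hP] : forall i, exists l : R, (i < m)%N ->
      \sum_(l < n) y n l ^+ i.+1 @[n --> \oo] --> l.
    move=> i; case: (ltnP i m) => im; last by exists 0.
    by have [l hl] := IH _ im; exists l.
  (* Newton's identity solved for the highest power sum, whose coefficient is the constant term 1/2
     of [lommel]. *)
  exists (- 2 * (m.+1%:R * g m.+1 + \sum_(i < m) g i.+1 * P (m - i.+1)%N)).
  have E n : \sum_(l < n) y n l ^+ m.+1 = - 2 * (m.+1%:R * (lommel nu n.+1)`_m.+1 +
      \sum_(i < m) (lommel nu n.+1)`_i.+1 * \sum_(l < n) y n l ^+ (m - i.+1).+1).
    have := newton n m; rewrite big_ord_recl/= lommel_coef0 subn0.
    set a := m.+1%:R * _; set b := \sum_(l < n) y n l ^+ m.+1.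
    by set c := \sum_(i < m) _; lra.
  rewrite (funext E); apply: cvgMr; apply: cvgD; first by apply: cvgMr; exact: cS.
  apply: (@cvg_sum_ord _ _ _ _ (fun i n => (lommel nu n.+1)`_i.+1 *
    \sum_(l < n) y n l ^+ (m - i.+1).+1) (fun i => g i.+1 * P (m - i.+1)%N)) => i im.
  by apply: cvgM; [exact: cS|apply: hP; lia].
exists P => // k.
have h : k.+1%:R * (lommel nu n.+1)`_k.+1 +
    \sum_(i < k.+1) (lommel nu n.+1)`_i * \sum_(l < n) y n l ^+ (k - i).+1 @[n --> \oo]
    --> k.+1%:R * g k.+1 + \sum_(i < k.+1) g i * P (k - i)%N.
  apply: cvgD; first by apply: cvgMr; exact: cS.
  apply: (@cvg_sum_ord _ _ _ _ (fun i n => (lommel nu n.+1)`_i *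
    \sum_(l < n) y n l ^+ (k - i).+1) (fun i => g i * P (k - i)%N)) => i ik.
  by apply: cvgM; [exact: cS|exact: hP].
rewrite (funext (fun n => newton n k)) in h.
exact: (cvg_unique (@Rhausdorff R) h (cvg_cst 0)).
Qed.

End CoefLimits.

(** * Orthogonality as a formal identity *)

(** The second solution of the [lommel] recurrence: the Pade numerators of [b_0 / G]. *)
Fixpoint lommel_assoc (R : realType) (nu : R) (n : nat) : {poly R} :=
  match n with
  | 0 => 0
  | 1 => 1
  | (k.+1 as m).+1 => lommel_assoc nu m - beta_coef nu m *: ('X * lommel_assoc nu k)
  end.

(* The reversal of [bessel_ortho nu n], in the variable x^2. *)
Fixpoint kernel_rev (R : realType) (nu : R) (n : nat) : {poly R} :=
  match n with
  | 0 => 1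
  | 1 => 1
  | (k.+1 as m).+1 => kernel_rev nu m - gamma_coef nu m.+1 *: ('X * kernel_rev nu k)
  end.

Section Formal.
Variables (R : realType) (nu : R).
Hypothesis nu_gt0 : 0 < nu.
Notation beta := (beta_coef nu).
Notation g := (bessel_prime_coef nu).
Notation A := (lommel_assoc nu).
Notation Pi := (kernel_rev nu).
Notation r n := ((lommel nu n).[nu ^+ 2]).

Lemma lommel_assocSS n : A n.+2 = A n.+1 - beta n.+1 *: ('X * A n).
Proof. by []. Qed.

Lemma kernel_revSS n : Pi n.+2 = Pi n.+1 - gamma_coef nu n.+2 *: ('X * Pi n).
Proof. by []. Qed.

Lemma size_rec_le (p q : {poly R}) (c : R) a : (size p <= a.+1)%N -> (size q <= a)%N ->
  (size (p - c *: ('X * q))%R <= a.+1)%N.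
Proof.
move=> hp hq; apply: (leq_trans (size_polyD _ _)); rewrite geq_max hp size_polyN/=.
apply: (leq_trans (size_scale_leq _ _)); apply: (leq_trans (size_polyMleq _ _)).
by rewrite size_polyX.
Qed.

Lemma size_lommel_assoc n : (size (A n) <= n.+1./2)%N.
Proof.
suff: (size (A n) <= n.+1./2)%N /\ (size (A n.+1) <= n.+2./2)%N by case.
elim: n => [|n [IH1 IH2]]; first by rewrite size_poly0 size_poly1.
split=> //; rewrite lommel_assocSS; apply: size_rec_le; last exact: IH1.
apply: (leq_trans IH2); rewrite ltnS.
have : (n./2 <= n.+1./2)%N by rewrite [n.+1./2]uphalf_half leq_addl.
exact.
Qed.

Lemma size_kernel_rev n : (size (Pi n) <= (n./2).+1)%N.
Proof.
suff: (size (Pi n) <= (n./2).+1)%N /\ (size (Pi n.+1) <= (n.+1./2).+1)%N by case.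
elim: n => [|n [IH1 IH2]]; first by rewrite size_poly1.
split=> //; rewrite kernel_revSS; apply: size_rec_le; last exact: IH1.
apply: (leq_trans IH2); rewrite ltnS.
have : (n.+1./2 <= n./2.+1)%N by rewrite [n.+1./2]uphalf_half; case: (odd n).
exact.
Qed.

(** The coefficient form of [4 nu s G' = (nu^2 - s) b_0 - 2 nu^2 G], which encodes Bessel's
    equation. *)
Lemma bessel_prime_coef_ode k : 4 * nu * (k.+1%:R * g k.+1) =
  nu ^+ 2 * bessel_coef nu 0 k.+1 - bessel_coef nu 0 k - 2 * nu ^+ 2 * g k.+1.
Proof.
have n1 : 0 < nu + 1 by rewrite ltr_wpDr.
have n2 : 0 < nu + 1 + k%:R by rewrite ltr_wpDr.
rewrite /bessel_prime_coef beta1E /bessel_coef.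
have -> : nu + 2 = nu + 1 + 1 by rewrite -addrA.
have Q0 : 0 < rising (nu + 1 + 1) k by rewrite rising_gt0// ltr_wpDr.
have E1 : rising (nu + 1) k.+1 = (nu + 1) * rising (nu + 1 + 1) k by exact: risingSl.
have E2 : rising (nu + 1) k = (nu + 1) * rising (nu + 1 + 1) k / (nu + 1 + k%:R).
  by rewrite -E1 risingSr mulfK// gt_eqF.
have f0 : (0 : R) < k`!%:R by rewrite ltr0n fact_gt0.
have k0 : (0 : R) < 1 + k%:R by rewrite ltr_wpDr.
rewrite E1 E2 factS natrM exprS -[k.+1]add1n natrD.
set Q := rising _ _ in Q0 *; set c := _ ^+ k; set f := _`!%:R in f0 *.
by field; rewrite !gt_eqF.
Qed.

Lemma lommel_nu2_gt0 n : 0 < r n.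
Proof. by have [] := lommel_nu2 nu_gt0 n. Qed.

Lemma horner_q n x : x != 0 -> (q nu n).[x] = x ^+ n * (lommel nu n).[x ^- 2].
Proof.
move=> x0.
suff: (q nu n).[x] = x ^+ n * (lommel nu n).[x ^- 2] /\
  (q nu n.+1).[x] = x ^+ n.+1 * (lommel nu n.+1).[x ^- 2] by case.
elim: n => [|n [IH1 IH2]]; first by rewrite /= !hornerE; split => //; rewrite mulrC.
split=> //; rewrite horner_lommelSS.
change (q nu n.+2) with ('X * q nu n.+1 - beta n.+1 *: q nu n).
rewrite hornerD hornerN hornerZ hornerM hornerX IH1 IH2 !exprS expr0.
by field.
Qed.

(** Reversal turns evaluation at [1 / nu] into evaluation at [nu ^+ 2]; the powers of [nu]
    cancel. *)
Lemma gamma_coefSS n : gamma_coef nu n.+2 = beta n.+1 * (r n.+3 * r n) / (r n.+2 * r n.+1).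
Proof.
have n0 : 1 / nu != 0 by rewrite div1r invr_eq0 gt_eqF.
rewrite /gamma_coef; case: eqP => [//|_]; rewrite subn1 subn2 addn1 -[n.+2.-2]/n -[n.+2.-1]/(n.+1).
rewrite !horner_q// [1 / nu]div1r -[nu^-1 ^- 2]exprVn invrK.
have rp := lommel_nu2_gt0; have h0 := rp n; have h1 := rp n.+1.
have h2 := rp n.+2; have h3 := rp n.+3.
have k1 := nuS_gt0 nu_gt0 n; have k2 := nuS_gt0 nu_gt0 n.+1.
have e1 : nu + n.+2%:R - 1 = nu + n.+1%:R by rewrite -[n.+2%:R]natr1 addrA addrK.
have e2 : nu + n.+2%:R - 2 = nu + n%:R.
  rewrite -[n.+2%:R]natr1 -[n.+1%:R]natr1; ring.
rewrite e1 e2 betaSE.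
set s0 := r n in h0 *; set s1 := r n.+1 in h1 *; set s2 := r n.+2 in h2 *.
set s3 := r n.+3 in h3 *; set u := nu + _ in k1 *; set v := nu + _ in k2 *.
rewrite !exprS; field.
by rewrite !gt_eqF// exprn_gt0 ?invr_gt0.
Qed.

(** The value of [sigma] for which [lommel nu n.+2 - sigma X lommel nu n] vanishes at [nu ^+ 2]. *)
Definition christoffel_ratio n : R := r n.+2 / (nu ^+ 2 * r n).
Notation sigma := christoffel_ratio.

(** Christoffel's formula in reversed form: [Pi n] is the combination on the right divided by
    [nu^2 - X], up to a constant. The proof shows that both sides obey the recurrence with
    coefficients [gamma_coef]. *)
Lemma christoffel_kernel n : (nu ^+ 2)%:P * Pi n - 'X * Pi n =
  (2 * nu ^+ 2)%:P * (lommel nu n.+2 - (sigma n)%:P * ('X * lommel nu n)).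
Proof.
have rp := lommel_nu2_gt0.
have n2 : nu ^+ 2 != 0 by rewrite expf_neq0// gt_eqF.
suff: (nu ^+ 2)%:P * Pi n - 'X * Pi n =
  (2 * nu ^+ 2)%:P * (lommel nu n.+2 - (sigma n)%:P * ('X * lommel nu n)) /\
  (nu ^+ 2)%:P * Pi n.+1 - 'X * Pi n.+1 =
  (2 * nu ^+ 2)%:P * (lommel nu n.+3 - (sigma n.+1)%:P * ('X * lommel nu n.+1)) by case.
elim: n => [|n [IH1 IH2]].
  have e2 : r 2 = 2^-1 - beta 1 * nu ^+ 2.
    by rewrite horner_lommelSS /= !hornerE.
  have e3 : r 3 = r 2 - beta 2 * nu ^+ 2 / 2.
    by rewrite (horner_lommelSS nu 1) /= !hornerE.
  have n3 : 2 * nu ^+ 2 != 0 by rewrite gt_eqF ?mulr_gt0 ?exprn_gt0.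
  have key (Z : {poly R}) : Z = ((2 * nu ^+ 2)^-1)%:P ->
      (nu ^+ 2)%:P - 'X = (2 * nu ^+ 2)%:P * ((2^-1)%:P - 'X * Z).
    move=> ->; rewrite mulrBr [_ * ('X * _)]mulrCA -!polyCM.
    rewrite [_ / (2 * _)]mulfV// polyC1 mulr1; congr (_%:P - _).
    by field.
  rewrite (_ : Pi 0 = 1)// (_ : Pi 1 = 1)// !mulr1; split.
    rewrite (key ((beta 1)%:P + (sigma 0)%:P)) /=; last first.
      rewrite -polyCD; congr _%:P; rewrite /christoffel_ratio e2 /= hornerC.
      by field; rewrite gt_eqF.
    by congr (_ * _); rewrite -mul_polyC; ring.
  rewrite (key ((beta 1)%:P + ((beta 2)%:P + (sigma 1)%:P) * (2^-1)%:P)) /=; last first.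
    rewrite -polyCD -polyCM -polyCD; congr _%:P; rewrite /christoffel_ratio e3 e2 /= hornerC.
    by field; rewrite gt_eqF.
  by congr (_ * _); rewrite -!mul_polyC; ring.
split => //.
(* [E] and [F] are the coefficient conditions for the right-hand side to obey the recurrence of
   [Pi]. *)
have E : sigma n.+1 + gamma_coef nu n.+2 = beta n.+3 + sigma n.+2.
  have h0 := rp n; have h1 := rp n.+1; have h2 := rp n.+2; have h3 := rp n.+3.
  have e2 := horner_lommelSS nu n (nu ^+ 2).
  have e4 := horner_lommelSS nu n.+2 (nu ^+ 2).
  have eb : beta n.+1 = (r n.+1 - r n.+2) / (nu ^+ 2 * r n).
    by rewrite e2; field; rewrite !gt_eqF.
  rewrite gamma_coefSS /christoffel_ratio e4 eb; field.
  by rewrite !gt_eqF.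
have F : gamma_coef nu n.+2 * sigma n = beta n.+1 * sigma n.+1.
  have h0 := rp n; have h1 := rp n.+1; have h2 := rp n.+2.
  rewrite gamma_coefSS /christoffel_ratio; field.
  by rewrite !gt_eqF.
have E' : sigma n.+2 = sigma n.+1 + gamma_coef nu n.+2 - beta n.+3 by rewrite E; ring.
have -> : (nu ^+ 2)%:P * Pi n.+2 - 'X * Pi n.+2 =
   ((nu ^+ 2)%:P * Pi n.+1 - 'X * Pi n.+1) -
   (gamma_coef nu n.+2)%:P * 'X * ((nu ^+ 2)%:P * Pi n - 'X * Pi n).
  by rewrite kernel_revSS -mul_polyC; ring.
rewrite IH1 IH2 E' (lommelSS nu n.+2) -mul_polyC.
have -> : lommel nu n.+2 = lommel nu n.+1 - (beta n.+1)%:P * ('X * lommel nu n).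
  by rewrite mul_polyC.
set T := (2 * nu ^+ 2)%:P; set L0 := lommel nu n; set L1 := lommel nu n.+1.
set L3 := lommel nu n.+3; rewrite polyCB polyCD.
have {}F : (gamma_coef nu n.+2)%:P * (sigma n)%:P = (beta n.+1)%:P * (sigma n.+1)%:P.
  by rewrite -!polyCM F.
set c := (gamma_coef nu n.+2)%:P in F *; set s0 := (sigma n)%:P in F *.
set b := (beta n.+1)%:P in F *; set s1 := (sigma n.+1)%:P in F *.
have -> : c * 'X * (T * (L1 - b * ('X * L0) - s0 * ('X * L0))) =
    c * 'X * T * (L1 - b * ('X * L0)) - T * ('X * 'X) * L0 * (c * s0) by ring.
by rewrite F; ring.
Qed.

Definition beta_prod n : R := \prod_(i < n) beta i.+1.

Lemma beta_prod_gt0 n : 0 < beta_prod n.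
Proof. by apply: prodr_gt0 => i _; exact: beta_gt0. Qed.

(* The remainder is, up to the factor [beta_prod n * X^n], the minimal
   solution of the recurrence satisfied by [lommel]. *)
Lemma lommel_pade M n : 'X^M %| lommel nu n * bessel_poly nu M 0 -
  (beta_prod n)%:P * ('X^n * bessel_poly nu M n) - bessel_prime_poly nu M * A n.
Proof.
pose b := bessel_poly nu M; pose G := bessel_prime_poly nu M.
pose D n := lommel nu n * b 0 - (beta_prod n)%:P * ('X^n * b n) - G * A n.
rewrite -/(D n); suff: ('X^M %| D n) /\ ('X^M %| D n.+1) by case.
elim: n => [|n [IH1 IH2]].
  split.
    rewrite (_ : D 0%N = 0) ?dvdp0//.
    rewrite /D /beta_prod big_ord0 polyC1 expr0 /=; ring.
  have := bessel_prime_polyE nu M; rewrite -dvdpNr.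
  congr (_ %| _); rewrite /D /beta_prod big_ord1 expr1 /= -!mul_polyC -/b -/G.
  by ring.
split => //; have BS k : (beta_prod k.+1)%:P = (beta_prod k)%:P * (beta k.+1)%:P :> {poly R}.
  by rewrite /beta_prod big_ord_recr /= (polyCM (\prod_(i < k) _)).
have -> : D n.+2 = D n.+1 - (beta n.+1)%:P * 'X * D n -
  (beta_prod n.+1)%:P * 'X^(n.+1) * (b n - (b n.+1 - beta n.+2 *: ('X * b n.+2))).
  rewrite /D lommelSS lommel_assocSS !BS !exprS -!mul_polyC.
  by set c := (beta_prod n)%:P; ring.
apply: dvdp_sub; last by apply: dvdp_mull; exact: bessel_poly_rec.
by apply: dvdp_sub => //; exact: dvdp_mull.
Qed.

Lemma bessel_prime_coef0 : g 0 = 2^-1.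
Proof. by rewrite /bessel_prime_coef bessel_coef0 mulr1 subr0. Qed.

(** * Moments of the kernels, from the differential equation and the Pade approximation *)

Section Moments.
Variable P : nat -> R.
Hypothesis newton : forall k, k.+1%:R * g k.+1 + \sum_(i < k.+1) g i * P (k - i)%N = 0.

Lemma bessel_prime_ode M : 'X^M %|
  (4 * nu)%:P * ('X * (bessel_prime_poly nu M * \poly_(m < M) P m)) +
  ((nu ^+ 2)%:P - 'X) * bessel_poly nu M 0 - (2 * nu ^+ 2)%:P * bessel_prime_poly nu M.
Proof.
apply/dvdXnP => i iM; rewrite mulrBl !(coefB, coefD) !coefCM !coefXM !coef_poly iM.
case: i iM => [|k] kM /=.
  by rewrite bessel_coef0 bessel_prime_coef0; field.
rewrite (ltnW kM) coefM_poly; last exact: ltnW.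
have -> : \sum_(i < k.+1) (bessel_prime_poly nu M)`_i * P (k - i)%N = - (k.+1%:R * g k.+1).
  apply/eqP; rewrite -addr_eq0 addrC -[X in _ == X](newton k); apply/eqP; congr (_ + _).
  apply: eq_bigr => i _; rewrite coef_poly (ltn_trans (ltn_ord i))//.
by rewrite mulrN bessel_prime_coef_ode; ring.
Qed.

(** By [bessel_ortho_moment] the two parts amount to orthogonality to lower powers and to the
    squared norm. The differential equation times [Pi n] turns, by [christoffel_kernel], into a
    combination of Pade remainders. *)
Lemma kernel_moment n :
  (forall j, (n.+1./2 <= j < n)%N -> (Pi n * \poly_(m < n.+2) P m)`_j = 0) /\
  (Pi n * \poly_(m < n.+2) P m)`_n = nu * sigma n * beta_prod n.
Proof.
set PP := \poly_(m < n.+2) P m.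
pose b := bessel_poly nu n.+2; pose G := bessel_prime_poly nu n.+2.
pose N := (nu ^+ 2)%:P : {poly R}; pose T := (2 * nu ^+ 2)%:P : {poly R}.
pose s := (sigma n)%:P : {poly R}; pose F := (4 * nu)%:P : {poly R}.
pose c0 := (beta_prod n)%:P : {poly R}; pose c2 := (beta_prod n.+2)%:P : {poly R}.
pose V := A n.+2 - s * ('X * A n) - Pi n.
pose W := F * ('X * (Pi n * PP)) + T * V.
have D : 'X^(n.+2) %| G * W - T * ('X^(n.+1) * (s * c0 * b n - c2 * ('X * b n.+2))).
  have -> : G * W - T * ('X^(n.+1) * (s * c0 * b n - c2 * ('X * b n.+2))) =
      Pi n * (F * ('X * (G * PP)) + (N - 'X) * b 0 - T * G) -
      T * (lommel nu n.+2 * b 0 - c2 * ('X^(n.+2) * b n.+2) - G * A n.+2) +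
      T * s * 'X * (lommel nu n * b 0 - c0 * ('X^n * b n) - G * A n).
    have E : (N - 'X) * b 0 * Pi n = T * (lommel nu n.+2 - s * ('X * lommel nu n)) * b 0.
      by rewrite -christoffel_kernel; ring.
    rewrite [Pi n * _]mulrC mulrBl mulrDl E !exprS /W /V.
    set x := 'X^n; by ring.
  apply: dvdp_add; first apply: dvdp_sub.
  - by apply: dvdp_mull; exact: bessel_prime_ode.
  - by apply: dvdp_mull; exact: lommel_pade.
  - by apply: dvdp_mull; exact: lommel_pade.
have G0 : G`_0 = 2^-1 by rewrite coef_poly bessel_prime_coef0.
(* As [G] has a nonzero constant term, it can be cancelled modulo powers of ['X]. *)
have cop : coprimep 'X^(n.+1) G.
  rewrite coprimep_expl// coprimep_sym -['X]subr0 -polyC0 coprimep_XsubC.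
  by rewrite rootE horner_coef0 G0 invr_eq0 pnatr_eq0.
have dW : 'X^(n.+1) %| W.
  rewrite -(Gauss_dvdpr _ cop); have := dvdp_trans (dvdp_exp2l 'X (leqnSn n.+1)) D.
  by rewrite dvdp_subl// dvdp_mull// dvdp_mulr.
(* The polynomial part [V] has too small a degree to affect the coefficients in question. *)
have V0 j : (n.+1./2 <= j)%N -> V`_j.+1 = 0.
  move=> hj; rewrite /V 2!coefB.
  have -> : (s * ('X * A n))`_j.+1 = sigma n * (A n)`_j by rewrite coefCM coefXM.
  rewrite [(A n.+2)`_j.+1]nth_default; last first.
    by apply: leq_trans (size_lommel_assoc _) _; rewrite ltnS.
  rewrite [(A n)`_j]nth_default; last exact: leq_trans (size_lommel_assoc _) _.
  rewrite [(Pi n)`_j.+1]nth_default ?mulr0 ?subr0//.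
  apply: leq_trans (size_kernel_rev _) _; rewrite ltnS; apply: leq_trans hj.
  by rewrite [n.+1./2]uphalf_half leq_addl.
have WE j : (n.+1./2 <= j)%N -> W`_j.+1 = 4 * nu * (Pi n * PP)`_j.
  by move=> hj; rewrite /W coefD !coefCM coefXM V0// mulr0 addr0.
have n4 : 4 * nu != 0 by rewrite mulf_neq0// gt_eqF.
split.
  move=> j /andP[hj jn]; apply: (mulfI n4); rewrite mulr0 -WE//.
  by move/dvdXnP: dW => /(_ j.+1); apply.
have hn : (n.+1./2 <= n)%N by case: (n) => // k; lia.
apply: (mulfI n4); rewrite -WE//.
have [U WU] := dvdpP _ _ dW.
have h1 : (G * W)`_n.+1 = 2^-1 * W`_n.+1.
  by rewrite WU mulrA !coefMXn ltnn subnn coef0M G0.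
have h2 : (T * ('X^(n.+1) * (s * c0 * b n - c2 * ('X * b n.+2))))`_n.+1 =
    2 * nu ^+ 2 * (sigma n * beta_prod n).
  rewrite coefCM coefXnM ltnn subnn coefB -[s * c0]polyCM !coefCM coefXM mulr0 subr0.
  by rewrite coef_poly/= bessel_coef0 mulr1.
move/dvdXnP: D => /(_ n.+1 (ltnSn _)); rewrite coefB h1 h2 => /subr0_eq h.
by apply: (mulfI (_ : 2^-1 != 0 :> R)); rewrite ?invr_eq0 ?pnatr_eq0// h; field.
Qed.

End Moments.

End Formal.

(** * The moment functional *)

Section MomentFunctional.
Local Open Scope classical_set_scope.
Variables (R : realType) (j : int -> R) (w : nat -> R).
Hypothesis j_gt0 : forall i : nat, 0 < j i.+1%:Z.
Hypothesis j_incr : forall i : nat, j i.+1%:Z < j i.+2%:Z.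
Hypothesis jN : forall i : nat, j (- i.+1%:Z) = - j i.+1%:Z.
Hypothesis jw : forall i : nat, (j i.+1%:Z ^+ 2)^-1 = w i.
Variable P : nat -> R.
Hypothesis wP : forall m, \sum_(i < K) w i ^+ m.+1 @[K --> \oo] --> P m.
Notation L := (moment_functional j).

Let x i : R := (j i.+1%:Z)^-1.

Let xx i : x i ^+ 2 = w i. Proof. by rewrite /x exprVn jw. Qed.

Let x_gt0 i : 0 < x i. Proof. by rewrite invr_gt0. Qed.

Let x_le i : x i <= x 0.
Proof.
elim: i => // i IH; apply: le_trans IH.
by rewrite lef_pV2 ?posrE// ltW.
Qed.

(** The weights are summable by [wP] at [m = 0]. It applies to polynomials because all nodes lie in
    [[- x 0, x 0]]. *)
Lemma weighted_series_cvg (u : nat -> R) (C : R) : (forall i, `|u i| <= C) ->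
  cvgn (series (fun i => w i * u i)).
Proof.
move=> uC; have C0 : 0 <= C by apply: le_trans (uC 0%N).
have w0 i : 0 <= w i by rewrite -xx exprn_ge0// ltW.
apply: normed_cvg; apply: (@series_le_cvg _ _ (fun i => C * w i)) => [i|i|i|] /=.
- by [].
- by rewrite mulr_ge0.
- by rewrite normrM ger0_norm// mulrC ler_wpM2r.
- apply/cvg_ex; exists (C * P 0).
  have -> : series (fun i => C * w i) = (fun K => C * \sum_(i < K) w i ^+ 1).
    apply/funext => K; rewrite seriesEord/= mulr_sumr.
    by apply: eq_bigr => i _; rewrite expr1.
  by apply: cvgMr; exact: wP.
Qed.

Lemma horner_bounded (f : {poly R}) : exists C : R, forall i, `|f.[x i]| <= C /\ `|f.[- x i]| <= C.
Proof.
have [C hC] := poly_itv_bound f (- x 0) (x 0).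
exists C => i; have h1 := x_gt0 i; have h2 := x_le i.
by split; apply: hC; apply/andP; split; lra.
Qed.

Lemma moment_functionalE f : L f =
  limn (series (fun i => w i * f.[x i])) + limn (series (fun i => w i * f.[- x i])).
Proof.
have H (T : nat -> R) (u : nat -> R) : (forall i, T i.+1 = w i * u i) ->
    cvgn (series (fun i => w i * u i)) ->
    \big[+%R/0]_(1 <= k <oo) T k = limn (series (fun i => w i * u i)).
  move=> Tu cu; apply/cvg_lim => //; rewrite -cvg_shiftS.
  suff -> : (fun n => \sum_(1 <= k < n.+1) T k) = series (fun i => w i * u i) by [].
  by apply/funext => n; rewrite seriesEnat/= big_add1/=; apply: eq_bigr => i _.
have [C hC] := horner_bounded f.
rewrite /moment_functional; congr (_ + _); apply: H.
- by move=> i; rewrite jw.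
- by apply: (@weighted_series_cvg _ C) => i; have [] := hC i.
- by move=> i; rewrite jN sqrrN jw invrN.
- by apply: (@weighted_series_cvg _ C) => i; have [] := hC i.
Qed.

Lemma moment_functional_linear (a : R) f h : L (a *: f + h) = a * L f + L h.
Proof.
have lin (s : nat -> R) : (forall f : {poly R}, cvgn (series (fun i => w i * f.[s i]))) ->
   limn (series (fun i => w i * (a *: f + h).[s i])) =
   a * limn (series (fun i => w i * f.[s i])) + limn (series (fun i => w i * h.[s i])).
  move=> cs; apply/cvg_lim => //.
  have -> : series (fun i => w i * (a *: f + h).[s i]) =
      (fun n => a * series (fun i => w i * f.[s i]) n + series (fun i => w i * h.[s i]) n).
    apply/funext => n; rewrite !seriesEnat/= mulr_sumr -big_split/=.
    by apply: eq_bigr => i _; rewrite hornerD hornerZ; ring.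
  by apply: cvgD; [apply: cvgMr; exact: cs|exact: cs].
rewrite !moment_functionalE !lin; first ring.
- by move=> g; have [C hC] := horner_bounded g;
    apply: (@weighted_series_cvg _ C) => i; have [] := hC i.
- by move=> g; have [C hC] := horner_bounded g;
    apply: (@weighted_series_cvg _ C) => i; have [] := hC i.
Qed.

Lemma moment_functional_odd m : odd m -> L 'X^m = 0.
Proof.
move=> om; rewrite moment_functionalE.
have [C hC] := horner_bounded 'X^m.
have cx : cvgn (series (fun i => w i * ('X^m).[x i])).
  by apply: (@weighted_series_cvg _ C) => i; have [] := hC i.
have -> : (fun i => w i * ('X^m).[- x i]) = - (fun i => w i * ('X^m).[x i]).
  apply/funext => i; rewrite [RHS]/GRing.opp/= !hornerXn exprNn -signr_odd om expr1.
  by rewrite mulN1r mulrN.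
by rewrite lim_seriesN// subrr.
Qed.

Lemma moment_functional_even m : L 'X^(m.*2) = 2 * P m.
Proof.
rewrite moment_functionalE.
have E (s : R) i : s ^+ 2 = w i -> w i * ('X^(m.*2)).[s] = w i ^+ m.+1.
  by move=> si; rewrite hornerXn -mul2n exprM si exprS.
have -> : (fun i => w i * ('X^(m.*2)).[- x i]) = (fun i => w i ^+ m.+1).
  by apply/funext => i; rewrite E// sqrrN.
have -> : (fun i => w i * ('X^(m.*2)).[x i]) = (fun i => w i ^+ m.+1).
  by apply/funext => i; rewrite E.
suff -> : limn (series (fun i => w i ^+ m.+1)) = P m by ring.
apply/cvg_lim => //.
have -> : series (fun i => w i ^+ m.+1) = (fun K => \sum_(i < K) w i ^+ m.+1).
  by apply/funext => K; rewrite seriesEord.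
exact: wP.
Qed.

End MomentFunctional.

(** * Orthogonality of the polynomials defined by the recurrence, and uniqueness *)

Section Orthogonality.
Variables (R : realType) (nu : R).
Hypothesis nu_gt0 : 0 < nu.
Variables (L : {poly R} -> R) (P : nat -> R).
Hypothesis Llin : forall a f h, L (a *: f + h) = a * L f + L h.
Hypothesis Lodd : forall m, odd m -> L 'X^m = 0.
Hypothesis Leven : forall m, L 'X^(m.*2) = 2 * P m.
Notation g := (bessel_prime_coef nu).
Hypothesis newton : forall k, k.+1%:R * g k.+1 + \sum_(i < k.+1) g i * P (k - i)%N = 0.

Let L0 : L 0 = 0.
Proof. by have := Llin (-1) 0 0; rewrite scaler0 addr0 mulN1r addNr. Qed.

Let LD f h : L (f + h) = L f + L h.
Proof. by have := Llin 1 f h; rewrite scale1r mul1r. Qed.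

Let LZ a f : L (a *: f) = a * L f.
Proof. by have := Llin a f 0; rewrite !addr0 L0 addr0. Qed.

Let LB f h : L (f - h) = L f - L h.
Proof. by rewrite -scaleN1r LD LZ mulN1r. Qed.

Lemma moment_orthogonal_le (p : {poly R}) n : (forall i, (i < n)%N -> L ('X^i * p) = 0) ->
  forall f : {poly R}, (size f <= n)%N -> L (f * p) = 0.
Proof.
move=> h f fn; rewrite -[f]coefK poly_def mulr_suml.
elim/big_rec: _ => [|i y _ yL]; first exact: L0.
by rewrite LD yL addr0 -scalerAl LZ h ?mulr0// (leq_trans (ltn_ord i)).
Qed.

Fixpoint bessel_ortho (n : nat) : {poly R} :=
  match n with
  | 0 => 1
  | 1 => 'X
  | (k.+1 as m).+1 => 'X * bessel_ortho m - gamma_coef nu m.+1 *: bessel_ortho k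
  end.
Notation ph := bessel_ortho.

Lemma bessel_orthoSS n : ph n.+2 = 'X * ph n.+1 - gamma_coef nu n.+2 *: ph n.
Proof. by []. Qed.

Lemma bessel_ortho_size_monic n : size (ph n) = n.+1 /\ ph n \is monic.
Proof.
suff: (size (ph n) = n.+1 /\ ph n \is monic) /\ (size (ph n.+1) = n.+2 /\ ph n.+1 \is monic) by case.
elim: n => [|n [[s1 m1] [s2 m2]]].
  by rewrite /= size_poly1 size_polyX monic1 monicX.
split => //; rewrite bessel_orthoSS.
have n0 : ph n.+1 != 0 by rewrite -size_poly_eq0 s2.
have sX : size ('X * ph n.+1) = n.+3 by rewrite mulrC size_mulX// s2.
have lt : (size (- (gamma_coef nu n.+2 *: ph n))%R < size ('X * ph n.+1)%R)%N.
  by rewrite size_polyN sX (leq_ltn_trans (size_scale_leq _ _))// s1.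
split; first by rewrite size_polyDl.
by rewrite monicE lead_coefDl// mulrC lead_coefMX -monicE.
Qed.

(** Since [ph n] is [x^n] times [kernel_rev nu n] at [x^(-2)], its pairing with the even moments is
    a Cauchy product; [K] is any sufficient truncation order. *)
Lemma bessel_ortho_moment n i K : ((n + i)./2 < K)%N -> L ('X^i * ph n) =
  if odd (n + i) then 0 else 2 * (kernel_rev nu n * \poly_(m < K) P m)`_((n + i)./2).
Proof.
pose S n := forall i, ((n + i)./2 < K)%N -> L ('X^i * ph n) =
  if odd (n + i) then 0 else 2 * (kernel_rev nu n * \poly_(m < K) P m)`_((n + i)./2).
suff: S n /\ S n.+1 by case=> + _; apply.
elim: n {i} => [|n [IH1 IH2]].
  have base i : (i./2 < K)%N -> L 'X^i = if odd i then 0 else 2 * (1 * \poly_(m < K) P m)`_i./2.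
    move=> iK; case: ifPn => oi; first exact: Lodd.
    by rewrite mul1r coef_poly iK -Leven even_halfK.
  split=> i iK; first by rewrite /= mulr1 base.
  by rewrite [ph 1]/= -exprSr base.
split => // i iK; rewrite bessel_orthoSS mulrBr mulrA -exprSr -scalerAr LB LZ.
rewrite IH2; last by rewrite addnS.
rewrite IH1; last by apply: leq_trans iK; rewrite !addSn ltnS.
rewrite addnS !addSn !oddS negbK; case: ifP => oi; first by rewrite mulr0 subr0.
rewrite (_ : (n + i).+2./2 = (n + i)./2.+1)//.
rewrite kernel_revSS [in RHS]mulrBl [in RHS]coefB -mul_polyC.
rewrite -[_%:P * _ * _]mulrA -['X * _ * _]mulrA coefCM coefXM.
by rewrite (_ : ((n + i)./2.+1 == 0)%N = false)// [_.+1.-1]/(_ ./2); ring.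
Qed.

Lemma bessel_ortho_orthogonal n i : (i < n)%N -> L ('X^i * ph n) = 0.
Proof.
move=> iN; rewrite (@bessel_ortho_moment n i n.+2); last by lia.
case: ifPn => // oi; have [h _] := kernel_moment nu_gt0 newton n.
by rewrite h ?mulr0//; apply/andP; split; lia.
Qed.

Lemma bessel_ortho_norm_neq0 n : L ('X^n * ph n) != 0.
Proof.
have e : ((n + n)./2 = n)%N by rewrite addnn doubleK.
rewrite (@bessel_ortho_moment n n n.+2) ?e//.
rewrite oddD addbb; have [_ ->] := kernel_moment nu_gt0 newton n.
have s0 : 0 < christoffel_ratio nu n.
  by rewrite /christoffel_ratio divr_gt0 ?mulr_gt0 ?exprn_gt0 ?lommel_nu2_gt0.
by rewrite gt_eqF// mulr_gt0// mulr_gt0 ?beta_prod_gt0// mulr_gt0.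
Qed.

(** The difference [d] has degree below [n] and is orthogonal to all such polynomials. Tested
    against [ph k], with [k] the degree of [d], it leaves its leading coefficient times a nonzero
    norm. *)
Lemma monic_orthogonal_unique p : monic_orthogonal L p -> p =1 ph.
Proof.
case=> pm ps po n; apply/eqP; rewrite -subr_eq0; apply/negPn/negP => d0.
set d := p n - ph n in d0.
have [hs hm] := bessel_ortho_size_monic n.
have pn (f : {poly R}) m : (m <= n)%N -> (size f <= m)%N -> L (f * p n) = 0.
  elim: m f => [|m IH] f mn sf.
    by move: sf; rewrite leqn0 size_poly_eq0 => /eqP->; rewrite mul0r L0.
  (* Subtracting a multiple of the monic [p m] lowers the size bound by one. *)
  have -> : f = f`_m *: p m + (f - f`_m *: p m) by rewrite addrC subrK.
  rewrite mulrDl LD -scalerAl LZ po ?mulr0 ?add0r; last by rewrite neq_ltn mn.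
  apply: IH; first exact: ltnW.
  apply/leq_sizeP => k; rewrite leq_eqVlt => /orP[/eqP<-|mk]; rewrite coefB coefZ.
    by have := pm m; rewrite monicE /lead_coef ps => /eqP->; rewrite mulr1 subrr.
  by rewrite (nth_default _ (leq_trans sf mk)) [(p m)`_k]nth_default ?mulr0 ?subr0 ?ps.
have sd : (size d <= n)%N.
  apply/leq_sizeP => k; rewrite leq_eqVlt => /orP[/eqP<-|nk]; rewrite coefB.
    have := pm n; rewrite monicE /lead_coef ps => /eqP->.
    by move: hm; rewrite monicE /lead_coef hs => /eqP->; rewrite subrr.
  by rewrite !nth_default ?subr0// ?ps ?hs.
have dE : forall f : {poly R}, (size f <= n)%N -> L (f * d) = 0.
  move=> f fn; rewrite mulrBr LB (pn f n)//.
  rewrite (moment_orthogonal_le (n := n))// ?subr0// => i; exact: bessel_ortho_orthogonal.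
pose k := (size d).-1.
have kd : size d = k.+1 by rewrite prednK// lt0n size_poly_eq0.
have [ks km] := bessel_ortho_size_monic k.
have := dE (ph k); rewrite ks -kd => /(_ sd).
have -> : ph k * d = lead_coef d *: ('X^k * ph k) + (d - lead_coef d *: 'X^k) * ph k.
  by rewrite mulrBl -scalerAl addrC subrK mulrC.
have low : L ((d - lead_coef d *: 'X^k) * ph k) = 0.
  apply: (@moment_orthogonal_le _ k) => [i|]; first exact: bessel_ortho_orthogonal.
  apply/leq_sizeP => i; rewrite leq_eqVlt => /orP[/eqP<-|ki].
    by rewrite coefB coefZ coefXn eqxx mulr1 /lead_coef -/k subrr.
  by rewrite coefB coefZ coefXn (gtn_eqF ki) mulr0 subr0 nth_default// kd.
rewrite LD LZ low addr0 => /eqP; rewrite mulf_eq0 lead_coef_eq0 (negbTE d0).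
by rewrite (negbTE (bessel_ortho_norm_neq0 k)).
Qed.

End Orthogonality.

Theorem theorem3p2 (R : realType) (nu : R) (j : int -> R) (p : nat -> {poly R})
    (hnu : 0 < nu)
    (hj : besselJ'_zeros nu j)
    (hp : monic_orthogonal (moment_functional j) p) :
  (forall n : nat, (1 <= n)%N ->
     extend p n%:Z - 'X * extend p (n%:Z - 1)
       + gamma_coef nu n *: extend p (n%:Z - 2) = 0)
  /\ extend p 0 = 1 /\ extend p 1 = 'X.
Proof.
have [y [yroots ymono]] := lommel_roots_exist hnu.
have [P yP newton] := power_sum_cvg hnu yroots.
have jw := zeros_root_lim hnu yroots ymono hj.
have wP m := root_lim_power_sum hnu yroots ymono (yP m).
have [jpos jincr _ jN] := hj.
have jpos' i : 0 < j i.+1%:Z by exact: jpos.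
have jincr' i : j i.+1%:Z < j i.+2%:Z by exact: jincr.
have jN' i : j (- i.+1%:Z) = - j i.+1%:Z by exact: jN.
have pE : p =1 bessel_ortho nu.
  apply: (monic_orthogonal_unique hnu _ _ _ newton hp).
  - exact: (moment_functional_linear jpos' jincr' jN' jw wP).
  - exact: (moment_functional_odd jpos' jincr' jN' jw wP).
  - exact: (moment_functional_even jpos' jincr' jN' jw wP).
split; last by rewrite /= !pE.
case=> [//|[|n]] _.
  have -> : (1%N%:Z - 1 = 0 :> int) by [].
  have -> : (1%N%:Z - 2 = Negz 0 :> int) by [].
  (* At [n = 1] the index [n - 2] is negative, where [extend] is 0. *)
  by rewrite /= !pE mulr1 subrr scaler0 addr0.
have -> : (n.+2%:Z - 1 = n.+1%:Z :> int) by lia.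
have -> : (n.+2%:Z - 2 = n%:Z :> int) by lia.
by rewrite /extend !pE bessel_orthoSS; ring.
Qed.
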